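(* Let $0<p<q$, let $$\Phi_{p,q}(t)=\frac{2^{it/p}\,\Gamma((1+it)/p)\,\Gamma(1/q)}{2^{it/q}\,\Gamma((1+it)/q)\,\Gamma(1/p)},\qquad t\in\mathbb{R},$$ and let $V_{p,q}$ be the unique (in law) strictly positive random variable, independent of $X_q$, such that $X_p\stackrel{d}{=}V_{p,q}X_q$. Then $\Phi_{p,q}\in L^1(\mathbb{R})$, and the function $$g_{p,q}(y)=\frac{1}{2\pi}\int_{\mathbb{R}}e^{-ity}\Phi_{p,q}(t)\,\mathrm{d}t,\qquad y\in\mathbb{R},$$ is a continuous density for $\log V_{p,q}$. Therefore $V_{p,q}$ has density $$f_{p,q}(v)=\frac1v\,g_{p,q}(\log v),\qquad v>0,$$ and in particular this function is nonnegative.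
   Context: For $r>0$, $X_r\sim N_r(0,1)$ means that $X_r$ is a real random variable with density $$f_r(x)=\frac{r}{2^{1+1/r}\Gamma(1/r)}\exp\left(-\frac{|x|^r}{2}\right),\qquad x\in\mathbb{R}.$$ For $0<p<q$, a strictly positive random variable $V_{p,q}$ independent of $X_q$ with $X_p\stackrel{d}{=}V_{p,q}X_q$ exists and its law is unique. The notation $\stackrel{d}{=}$ means equality in distribution. For $c\in\{p,q\}$, $2^{it/c}=e^{i(t/c)\log 2}$. *)

(* Defs.v *)
From HB Require Import structures.
From mathcomp Require Import all_boot all_order all_algebra.
From mathcomp Require Import all_classical all_reals all_analysis.

Set Implicit Arguments.
Unset Strict Implicit.
Unset Printing Implicit Defensive.

Import Order.TTheory GRing.Theory Num.Theory.
Import numFieldNormedType.Exports.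
From mathcomp Require Import complex.

Local Open Scope classical_set_scope.
Local Open Scope ring_scope.
Local Open Scope complex_scope.

Definition expC (R : realType) (z : R[i]) : R[i] :=
  (expR (Re z))%:C * (cos (Im z) +i* sin (Im z)).

(* [normc] is the R-valued modulus on R[i]; measurability of a complex-valued
   function is measurability of its real and imaginary parts. *)
Definition L1C (R : realType) (f : R -> R[i]) : Prop :=
  [/\ measurable_fun setT (fun x => Re (f x)),
      measurable_fun setT (fun x => Im (f x)) &
      (\int[@lebesgue_measure R]_x (ComplexField.Normc.normc (f x))%:E < +oo)%E].

(* Meaningful when [f] is integrable on [D]; [Rintegral] is total. *)
Definition integralC (R : realType) (D : set R) (f : R -> R[i]) : R[i] :=
  Rintegral (@lebesgue_measure R) D (fun x => Re (f x)) +i*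
  Rintegral (@lebesgue_measure R) D (fun x => Im (f x)).

(* Euler's integral of [x `^ (z - 1) * exp (- x)], with
   [x `^ (z - 1) = exp ((z - 1) * ln x)]; it represents the Gamma function on
   the half-plane [0 < Re z], which contains all the arguments used below. *)
Definition GammaC (R : realType) (z : R[i]) : R[i] :=
  integralC `]0, +oo[ (fun x => expC ((z - 1) * (ln x)%:C - x%:C)).

(* [GammaC] is real at real arguments, hence the real part. *)
Definition gnormal_pdf (R : realType) (r : R) (x : R) : R :=
  r / (2 `^ (1 + r^-1) * Re (GammaC (r^-1)%:C)) * expR (- (`|x| `^ r / 2)).

Definition has_density d (T : measurableType d) (R : realType)
    (P : probability T R) (X : T -> R) (f : R -> R) : Prop :=
  [/\ measurable_fun setT f,
      forall x, 0 <= f x &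
      forall A : set R, measurable A ->
        pushforward P X A = (\int[@lebesgue_measure R]_(x in A) (f x)%:E)%E].

Definition eq_in_law d (T : measurableType d) d' (T' : measurableType d')
    (R : realType) (P : probability T R) (X : T -> R)
    (P' : probability T' R) (X' : T' -> R) : Prop :=
  forall A : set R, measurable A -> pushforward P X A = pushforward P' X' A.

Definition independent_RV d (T : measurableType d) (R : realType)
    (P : probability T R) (X Y : T -> R) : Prop :=
  forall A B : set R, measurable A -> measurable B ->
    P ((X @^-1` A) `&` (Y @^-1` B)) = (P (X @^-1` A) * P (Y @^-1` B))%E.

(* [pow2i c t] is [2 ^ (i t / c) = exp (i (t / c) log 2)]. *)
Definition pow2i (R : realType) (c t : R) : R[i] :=
  expC (0 +i* (t / c * ln 2)).

Definition Phi (R : realType) (p q t : R) : R[i] :=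
  (pow2i p t * GammaC ((1 +i* t) / p%:C) * GammaC (q^-1)%:C) /
  (pow2i q t * GammaC ((1 +i* t) / q%:C) * GammaC (p^-1)%:C).

Definition gpq (R : realType) (p q y : R) : R[i] :=
  ((2 * pi)^-1)%:C *
  integralC setT (fun t => expC (0 +i* (- (t * y))) * Phi p q t).

Definition fpq (R : realType) (p q v : R) : R :=
  v^-1 * Re (gpq p q (ln v)).

(* Main.v *)
Require Import Defs.
From HB Require Import structures.
From mathcomp Require Import all_boot all_order all_algebra.
From mathcomp Require Import all_classical all_reals all_analysis.
From mathcomp Require Import measurable_realfun ring lra.

Import Order.TTheory GRing.Theory Num.Theory.
Import numFieldNormedType.Exports.
From mathcomp Require Import complex.

Set Implicit Arguments.
Unset Strict Implicit.
Unset Printing Implicit Defensive.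
Local Open Scope classical_set_scope.
Local Open Scope ring_scope.

(** Put psi_r(t) = E |X_r|^(it). As |X_r|^r / 2 has the Gamma law of parameter
    1/r, psi_r(t) = 2^(it/r) Gamma((1+it)/r) / Gamma(1/r). Independence turns
    X_p = V X_q into psi_p = psi_V psi_q with psi_V(t) = E e^(it log V), and
    psi_q has no zero, so Phi is the characteristic function of log V.

    Integrability of Phi does not need Stirling's formula: iterating
    Gamma(z+1) = z Gamma(z) gives
      |psi_r(t)|^2 = prod_(k >= 0) (1+kr)^2 / ((1+kr)^2 + t^2),
    whose factors increase with r. For k >= 1 and 1 + k q <= |t| the factor of p
    is at most c < 1 times that of q, with c independent of k and t; there are
    about |t|/q such k, whence |Phi(t)|^2 <= K e^(-l |t|). In the finite
    products, the tails are controlled by 1/4 <= |Gamma(a+is)|^2 / Gamma(a)^2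
    <= 1 for 1 + 4 s^2 < a.

    Fourier inversion is done by inserting e^(-e |t|): the regularized integral
    at y is E p_e(log V - y), with p_e the Poisson kernel; hence the density is
    nonnegative, and letting e tend to 0 identifies the law of log V. The
    density of V follows by the substitution y = log v. *)

(** The law of log V is accessible only through its characteristic function, so neither a density
    nor the absence of atoms is available beforehand. The weight e^(-e |t|) serves three purposes:
    it makes the double integral in t and over the probability space absolutely convergent, its
    transform is positive, and that transform has the primitive arctan. The regularized density
    therefore integrates over [a, b] to an expected difference of arctangents, which tends to 1
    inside the interval, 1/2 at its endpoints and 0 outside. The endpoints are harmless because the
    limit density is bounded, which excludes atoms.

    In the comparison of the products, (1+kp)/(1+kq) decreases in k, so k = 1 is the worst case,
    while the factors for k = 0 coincide. The number of factors may depend on t as long as the final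
    bound does not: only the contracted ones are counted, and the remainders cost a fixed constant.
    No infinite product is formed.

    Complex numbers appear only where the definitions impose them; all analysis is carried out on
    pairs of real integrals with cos and sin. *)

(** * Integration against densities and uniqueness of measures *)

Lemma cvg_Rintegral_dominated d (T : measurableType d) (R : realType)
    (mu : {measure set T -> \bar R}) (D : set T) (f_ : nat -> T -> R)
    (f g : T -> R) :
  measurable D -> (forall n, measurable_fun D (f_ n)) -> measurable_fun D f ->
  (forall x, D x -> f_ n x @[n --> \oo] --> f x) ->
  mu.-integrable D (EFin \o g) ->
  (forall n x, D x -> `|f_ n x| <= g x) ->
  Rintegral mu D (f_ n) @[n --> \oo] --> Rintegral mu D f.
Proof.
move=> mD mf_ mf cf ig fg.
have [intf _ cvf] : [/\ mu.-integrable D (EFin \o f),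
    [sequence \int[mu]_(x in D) `|(f_ n x)%:E - (f x)%:E|]_n @ \oo --> 0 &
    [sequence \int[mu]_(x in D) (f_ n x)%:E]_n @ \oo -->
      \int[mu]_(x in D) (f x)%:E]%E.
  apply: (@dominated_convergence _ _ _ mu D mD
    (fun n => EFin \o f_ n) (EFin \o f) (EFin \o g)) => //=.
  - by move=> n; apply/measurable_EFinP.
  - exact/measurable_EFinP.
  - by apply: aeW => x Dx; apply: cvg_EFin; [exact: nearW|exact: cf].
  - by apply: aeW => x n Dx; rewrite lee_fin fg.
apply: fine_cvg; rewrite fineK //.
exact: integrable_fin_num.
Qed.

Import HBNNSimple.

(** The hypothesis on [nu] is the case of indicators; linearity gives simple functions and monotone
    convergence, applied on both sides to the same approximating sequence, gives all nonnegative
    [h]. *)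
Lemma ge0_integral_density d (T : measurableType d) (R : realType)
    (nu mu : {measure set T -> \bar R}) (f : T -> R) (h : T -> \bar R) :
  measurable_fun setT f -> (forall x, 0 <= f x) ->
  (forall A, measurable A -> nu A = (\int[mu]_(x in A) (f x)%:E)%E) ->
  measurable_fun setT h -> (forall x, (0 <= h x)%E) ->
  (\int[nu]_x h x = \int[mu]_x (h x * (f x)%:E))%E.
Proof.
move=> mf f0 nuE mh h0; pose a := nnsfun_approx measurableT mh.
have ah x : (EFin \o a ^~ x) n @[n --> \oo] --> h x.
  exact: cvg_nnsfun_approx.
have -> : (\int[nu]_x h x = lim (\int[nu]_x (EFin \o a n) x @[n --> \oo]))%E.
  rewrite (_ : h = fun x => lim ((EFin \o a n) x @[n --> \oo])); last first.
    by apply/funext => x; apply/esym/cvg_lim => //; exact: ah.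
  apply: monotone_convergence => //.
  - by move=> n; apply/measurable_EFinP.
  - by move=> n x _ /=; rewrite lee_fin.
  - by move=> x _ m n mn; rewrite lee_fin; exact/lefP/nd_nnsfun_approx.
have -> : (\int[mu]_x (h x * (f x)%:E) =
    lim (\int[mu]_x ((EFin \o a n) x * (f x)%:E) @[n --> \oo]))%E.
  rewrite (_ : (fun x => _) =
    fun x => lim ((EFin \o a n) x * (f x)%:E @[n --> \oo])%E); last first.
    apply/funext => x; apply/esym/cvg_lim => //.
    by apply: cvgeZr => //; exact: ah.
  apply: monotone_convergence => //.
  - by move=> n; apply: emeasurable_funM; exact/measurable_EFinP.
  - by move=> n x _ /=; rewrite lee_fin mulr_ge0.
  - move=> x _ m n mn /=; rewrite lee_fin ler_wpM2r//.
    exact/lefP/nd_nnsfun_approx.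
suff suf n : (\int[nu]_x (EFin \o a n) x =
    \int[mu]_x ((EFin \o a n) x * (f x)%:E))%E by under eq_fun do rewrite suf.
transitivity (\int[nu]_x
   (\sum_(y \in range (a n)) (y * \1_(a n @^-1` [set y]) x)%:E))%E.
  by apply: eq_integral => t _; rewrite /= fimfunE -fsumEFin.
rewrite ge0_integral_fsum//; last 2 first.
- by move=> y; apply/measurable_EFinP; exact: measurable_funM.
- by move=> y x _; exact: nnfun_muleindic_ge0.
transitivity (\int[mu]_x (\sum_(y \in range (a n))
    (y * \1_(a n @^-1` [set y]) x)%:E * (f x)%:E))%E; last first.
  apply: eq_integral => x _.
  rewrite -ge0_mule_fsuml => [|y]; last exact: nnfun_muleindic_ge0.
  by rewrite fsumEFin // -(fimfunE _ x).
rewrite ge0_integral_fsum//; last 2 first.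
- move=> y; apply: emeasurable_funM; last exact/measurable_EFinP.
  by apply/measurable_EFinP; exact: measurable_funM.
- move=> y x _; apply: mule_ge0; last by rewrite lee_fin.
  exact: nnfun_muleindic_ge0.
apply: eq_fsbigr => r rn.
rewrite integralZl_indic_nnsfun//.
have mr : measurable (a n @^-1` [set r]) by [].
rewrite integral_indic//= setIT nuE//.
under [RHS]eq_integral do rewrite EFinM -muleA.
have r0 : 0 <= r by move: rn; rewrite inE => -[x _ <-].
rewrite ge0_integralZl//; last 2 first.
- by apply: emeasurable_funM; apply/measurable_EFinP => //; exact: measurable_indic.
- by move=> y _; rewrite mule_ge0 ?lee_fin.
congr (_ * _)%E; rewrite integral_mkcond; apply: eq_integral => y _.
by rewrite patchE indicE; case: ifP => _; rewrite ?mul1e ?mul0e.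
Qed.

(** Half-open intervals are stable under intersection and generate the Borel sets; the intervals
    []-n, n]] exhaust the line with finite mass. *)
Lemma eq_measure_itvoc (R : realType)
    (m1 m2 : {measure set (measurableTypeR R) -> \bar R}) :
  (m1 setT < +oo)%E ->
  (forall a b : R, a < b -> m1 `]a, b]%classic = m2 `]a, b]%classic) ->
  forall A : set R, measurable A -> m1 A = m2 A.
Proof.
move=> m1oo m12 A mA.
apply: (@measure_unique _ _ (measurableTypeR R) (@ocitv R)
  (fun n => `](- n%:R), n%:R]%classic)) => //.
- exact: ocitvI.
- by move=> k; exact: is_ocitv.
- apply/seteqP; split => // x _; exists (Num.trunc `|x|).+1 => //=.
  by have := truncnS_gt `|x|; rewrite in_itv/= ltr_norml => /andP[-> /ltW].
- move=> _ [[a b] _ <-]/=; have [ab|ba] := ltP a b; first exact: m12.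
  by rewrite set_itv_ge ?measure0// bnd_simp -leNgt.
- by move=> k; apply: le_lt_trans m1oo; apply: le_measure; rewrite ?inE.
Qed.

(* The logarithm transports the statement on ]0, +oo[ to [eq_measure_itvoc]. *)
Lemma eq_measure_pos (R : realType)
    (m1 m2 : {measure set (measurableTypeR R) -> \bar R}) :
  (m1 setT < +oo)%E ->
  m1 `]-oo, 0]%classic = 0%E -> m2 `]-oo, 0]%classic = 0%E ->
  (forall a b : R, 0 < a -> a < b -> m1 `]a, b]%classic = m2 `]a, b]%classic) ->
  forall A : set R, measurable A -> m1 A = m2 A.
Proof.
move=> m1oo m10 m20 m12.
have pos (m : {measure set (measurableTypeR R) -> \bar R}) (A : set R) :
    m `]-oo, 0]%classic = 0%E -> measurable A ->
    m A = m (A `&` `]0, +oo[%classic).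
  move=> m0 mA; rewrite -{1}(setIT A) -(setUv `]0, +oo[%classic) setIUr.
  apply: measureU0; try exact: measurableI.
  - by apply: measurableI => //; exact: measurableC.
  - apply: subset_measure0 m0 => //.
    + by apply: measurableI => //; exact: measurableC.
    + by move=> x [_]; rewrite set_itvE/= => /negP; rewrite -leNgt in_itv/=.
have lnoc a b : (@ln R) @^-1` `]a, b] `&` `]0, +oo[ = `]expR a, expR b]%classic.
  apply/seteqP; split => x /=; rewrite !in_itv/= ?andbT.
    by move=> [/andP[ax xb] x0]; rewrite -[x]lnK// ltr_expR ler_expR ax.
  move=> /andP[ax xb]; have x0 := lt_trans (expR_gt0 a) ax.
  by split => //; rewrite -ltr_expR -ler_expR lnK// ax.
have ml : measurable_fun [set: measurableTypeR R] (@ln R : _ -> measurableTypeR R).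
  exact: measurable_ln.
move=> A mA.
have eqp B : measurable B -> pushforward m1 (@ln R) B = pushforward m2 (@ln R) B.
  apply: (@eq_measure_itvoc _ (pushforward m1 (@ln R : _ -> measurableTypeR R))
    (pushforward m2 (@ln R : _ -> measurableTypeR R))).
    exact: m1oo.
  move=> a b ab.
  have mab : measurable ((@ln R) @^-1` `]a, b]).
    by rewrite -[X in measurable X]setTI; exact: ml.
  change (m1 ((@ln R) @^-1` `]a, b]) = m2 ((@ln R) @^-1` `]a, b])).
  rewrite (pos m1 _ m10 mab) (pos m2 _ m20 mab) lnoc m12 ?expR_gt0//.
  by rewrite ltr_expR.
rewrite (pos m1)// (pos m2)//.
have -> : A `&` `]0, +oo[ = (@ln R) @^-1` (expR @^-1` A) `&` `]0, +oo[.
  apply/seteqP; split => x /=; rewrite !in_itv/= andbT => -[+ x0];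
  by rewrite lnK.
have mB : measurable (expR @^-1` A : set R).
  by rewrite -[X in measurable X]setTI; exact: measurable_expR.
rewrite -(pos m1)//; last by rewrite -[X in measurable X]setTI; exact: ml.
rewrite -(pos m2)//; last by rewrite -[X in measurable X]setTI; exact: ml.
exact: eqp.
Qed.

Section real_integrable.
Context d (T : measurableType d) (R : realType) (mu : {measure set T -> \bar R}).
Variables (D : set T) (mD : measurable D).
Implicit Types f g h : T -> R.

Lemma integrableDr f g : mu.-integrable D (EFin \o f) ->
  mu.-integrable D (EFin \o g) -> mu.-integrable D (EFin \o (fun x => f x + g x)).
Proof.
move=> fi gi; apply: eq_integrable (integrableD mD fi gi) => //.
Qed.

Lemma integrableBr f g : mu.-integrable D (EFin \o f) ->
  mu.-integrable D (EFin \o g) -> mu.-integrable D (EFin \o (fun x => f x - g x)).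
Proof.
move=> fi gi; apply: eq_integrable (integrableB mD fi gi) => //.
Qed.

Lemma integrableZr_EFin (c : R) f : mu.-integrable D (EFin \o f) ->
  mu.-integrable D (EFin \o (fun x => c * f x)).
Proof.
move=> fi; apply: eq_integrable (integrableZl mD c fi) => //.
Qed.

Lemma integrableM_bounded f h (M : R) : mu.-integrable D (EFin \o f) ->
  measurable_fun D h -> (forall x, D x -> `|h x| <= M) ->
  mu.-integrable D (EFin \o (fun x => f x * h x)).
Proof.
move=> fi mh hM; apply: (le_integrable mD _ _ (integrableZr_EFin M fi)).
  have /measurable_EFinP mf := measurable_int mu fi.
  by apply/measurable_EFinP; exact: measurable_funM.
move=> x Dx; rewrite /= lee_fin !normrM mulrC ler_wpM2r//.
exact: le_trans (hM x Dx) (ler_norm _).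
Qed.

End real_integrable.

(** * Differentiation rules for explicit functions and the fundamental theorem of calculus *)

Section is_derive_lambda.
Variable R : realType.
Variables (f g : R -> R) (x df dg : R).
Hypotheses (Df : is_derive x 1 f df) (Dg : is_derive x 1 g dg).

Lemma is_derive_addf : is_derive x 1 (fun y => f y + g y) (df + dg).
Proof. exact: is_deriveD. Qed.

Lemma is_derive_subf : is_derive x 1 (fun y => f y - g y) (df - dg).
Proof. exact: is_deriveB. Qed.

Lemma is_derive_mulf : is_derive x 1 (fun y => f y * g y) (df * g x + f x * dg).
Proof.
by have H := is_deriveM Df Dg; apply: is_derive_eq; rewrite /GRing.scale/= addrC mulrC.
Qed.

Lemma is_derive_cmulf (c : R) : is_derive x 1 (fun y => c * f y) (c * df).
Proof. exact: (@is_deriveZ R R R f c x 1 df Df). Qed.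

Lemma is_derive_compf (h : R -> R) (dh : R) :
  is_derive (f x) 1 h dh -> is_derive x 1 (fun y => h (f y)) (dh * df).
Proof. by move=> Dh; exact: is_derive1_comp. Qed.

End is_derive_lambda.

Lemma is_derive_invf (R : realType) (f : R -> R) (x df : R) :
  f x != 0 -> is_derive x 1 f df ->
  is_derive x 1 (fun y => (f y)^-1) (- (df / f x ^+ 2)).
Proof.
move=> fx Df; have H := is_deriveV fx Df.
by apply: is_derive_eq; rewrite /GRing.scale/= mulNr mulrC.
Qed.

Lemma is_derive_oppf (R : realType) (f : R -> R) (x df : R) :
  is_derive x 1 f df -> is_derive x 1 (fun y => - f y) (- df).
Proof. by move=> Df; exact: is_deriveN. Qed.

Lemma is_derive_continuous (R : realType) (F : R -> R) (x df : R) :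
  is_derive x 1 F df -> {for x, continuous F}.
Proof.
by move=> dF; apply: differentiable_continuous; apply/derivable1_diffP.
Qed.

Lemma integral_is_derive (R : realType) (f F : R -> R) (a b : R) :
  a <= b ->
  (forall x, a <= x <= b -> {for x, continuous f}) ->
  (forall x, a <= x <= b -> is_derive x 1 F (f x)) ->
  (\int[@lebesgue_measure R]_(x in `[a, b]) (f x)%:E = (F b - F a)%:E)%E.
Proof.
rewrite le_eqVlt => /predU1P[->|ab] cf dF.
  by rewrite set_itv1 integral_set1 subrr.
have cF x : a <= x <= b -> {for x, continuous F}.
  by move=> /dF; exact: is_derive_continuous.
rewrite EFinB; apply: continuous_FTC2 => //.
- apply: continuous_in_subspaceT => x; rewrite inE/= in_itv/=; exact: cf.
- split.
  + move=> x; rewrite in_itv/= => /andP[ax xb].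
    by have [] := dF x _; rewrite ?(ltW ax) ?(ltW xb).
  + by apply: cvg_at_right_filter; apply: cF; rewrite lexx ltW.
  + by apply: cvg_at_left_filter; apply: cF; rewrite lexx ltW.
- move=> x; rewrite in_itv/= => /andP[ax xb].
  by rewrite derive1E; have [] := dF x _; rewrite ?(ltW ax) ?(ltW xb).
Qed.

(** * Integrals over the positive half-line by means of an antiderivative *)

Section half_line.
Variable R : realType.
Local Notation mu := (@lebesgue_measure R).
Local Notation pos := (`]0, +oo[%classic : set R).

(** This exhaustion of the half-line has endpoints with logarithms [-n] and [n], so boundary terms
    built from [ln] become explicit sequences. *)
Definition expR_itv (n : nat) : set R := `[expR (- n%:R), expR n%:R]%classic.

Lemma bigcup_expR_itv : \bigcup_n expR_itv n = pos.
Proof.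
apply/seteqP; split => x /=.
  by move=> [n _] /=; rewrite !in_itv/= andbT => /andP[+ _]; apply: (lt_le_trans (expR_gt0 _)).
rewrite in_itv/= andbT => x0; exists (Num.trunc `|ln x|).+1 => //=.
have := truncnS_gt `|ln x|; set N := (Num.trunc _).+1.
rewrite ltr_norml => /andP[l1 l2].
by rewrite /expR_itv/= in_itv/= -[x]lnK// !ler_expR !ltW.
Qed.

Lemma nondecreasing_expR_itv : nondecreasing_seq expR_itv.
Proof.
move=> m n mn; apply/subsetPset => x; rewrite /expR_itv/= !in_itv/= => /andP[x1 x2].
by rewrite (le_trans _ x1) ?(le_trans x2)// ler_expR ?lerN2 ler_nat.
Qed.

Lemma measurable_fun_pos (f : R -> R) :
  (forall x : R, 0 < x -> {for x, continuous f}) -> measurable_fun pos f.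
Proof.
move=> cf; apply: open_continuous_measurable_fun; first exact: interval_open.
by move=> x; rewrite inE/= in_itv/= andbT; exact: cf.
Qed.

Lemma expR_itv_sub n : expR_itv n `<=` pos.
Proof. by rewrite -bigcup_expR_itv => x nx; exists n. Qed.

Let expR_itv_gt0 (n : nat) (x : R) : expR (- n%:R) <= x <= expR n%:R -> 0 < x.
Proof. by move=> /andP[+ _]; apply: (lt_le_trans (expR_gt0 _)). Qed.

Let le_expRN n : expR (- n%:R) <= expR n%:R :> R.
Proof. by rewrite ler_expR lerNl (@le_trans _ _ 0) ?oppr_le0. Qed.

Let integral_expR_itv (f F : R -> R) (n : nat) :
  (forall x : R, 0 < x -> {for x, continuous f}) ->
  (forall x : R, 0 < x -> is_derive x 1 F (f x)) ->
  (\int[mu]_(x in expR_itv n) (f x)%:E =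
    (F (expR n%:R) - F (expR (- n%:R)))%:E)%E.
Proof.
move=> cf dF; apply: integral_is_derive => //.
- by move=> x /expR_itv_gt0; exact: cf.
- by move=> x /expR_itv_gt0; exact: dF.
Qed.

(** Each integral over [expR_itv n] is a difference of two values of [F], hence at most [2 B]; a
    bound on [F] thus replaces limits at 0 and at infinity. *)
Lemma integrable_pos_is_derive (f F : R -> R) (B : R) :
  (forall x : R, 0 < x -> 0 <= f x) ->
  (forall x : R, 0 < x -> {for x, continuous f}) ->
  (forall x : R, 0 < x -> is_derive x 1 F (f x)) ->
  (forall x : R, 0 < x -> `|F x| <= B) ->
  mu.-integrable pos (EFin \o f).
Proof.
move=> f0 cf dF FB; apply/integrableP; split.
  by apply/measurable_EFinP; exact: measurable_fun_pos.
have -> : (\int[mu]_(x in pos) `|(EFin \o f) x| = \int[mu]_(x in pos) (f x)%:E)%E.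
  apply: eq_integral => x; rewrite inE/= in_itv/= andbT => x0.
  by rewrite /= ger0_norm// f0.
have mf : measurable_fun pos (EFin \o f).
  by apply/measurable_EFinP; exact: measurable_fun_pos.
rewrite -bigcup_expR_itv.
have cvI : (\int[mu]_(x in expR_itv n) (f x)%:E @[n --> \oo] -->
    \int[mu]_(x in \bigcup_n expR_itv n) (f x)%:E)%E.
  apply: ge0_nondecreasing_set_cvg_integral.
  - exact: nondecreasing_expR_itv.
  - by move=> n; exact: measurable_itv.
  - by move=> n; apply: measurable_funS mf => //; exact: expR_itv_sub.
  - by move=> i x /expR_itv_sub/=; rewrite in_itv/= andbT lee_fin; exact: f0.
apply: (@le_lt_trans _ _ (B + B)%:E); last exact: ltry.
rewrite -(cvg_lim _ cvI)//.
apply: lime_le; first exact: cvgP cvI.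
apply: nearW => n; rewrite (integral_expR_itv n cf dF).
rewrite lee_fin (le_trans (ler_norm _))// (le_trans (ler_normB _ _))//.
by rewrite lerD ?FB ?expR_gt0.
Qed.

Lemma Rintegral_pos_is_derive (f F : R -> R) (l0 l1 : R) :
  (forall x : R, 0 < x -> {for x, continuous f}) ->
  (forall x : R, 0 < x -> is_derive x 1 F (f x)) ->
  mu.-integrable pos (EFin \o f) ->
  F (expR (- n%:R)) @[n --> \oo] --> l0 ->
  F (expR n%:R) @[n --> \oo] --> l1 ->
  Rintegral mu pos f = l1 - l0.
Proof.
move=> cf dF fi F0 F1.
have mf := measurable_fun_pos cf.
have : Rintegral mu pos (f \_ (expR_itv n)) @[n --> \oo] --> Rintegral mu pos f.
  apply: (@cvg_Rintegral_dominated _ _ R mu pos (fun n => f \_ (expR_itv n)) f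
    (Num.norm \o f)) => //.
  - move=> n; apply/measurable_restrict => //; first exact: measurable_itv.
    by apply: measurable_funS mf => //; exact: subIsetl.
  - move=> x; rewrite -bigcup_expR_itv => -[N _ Nx].
    apply: cvg_near_cst; near=> n; rewrite patchE ifT// inE.
    have Nn : (N <= n)%N by near: n; exact: nbhs_infty_ge.
    by have /subsetPset := nondecreasing_expR_itv Nn; exact.
  - exact: integrable_norm.
  - move=> n x _; rewrite patchE; case: ifP => // _.
    (* Outside the set a restricted function takes the default value [point], which is 0 in [R]. *)
    by rewrite (_ : point = 0 :> R)// normr0 /=.
have -> : (fun n => Rintegral mu pos (f \_ (expR_itv n))) =
    (fun n => F (expR n%:R) - F (expR (- n%:R))).
  apply/funext => n; rewrite -Rintegral_mkcondr setIidr; last exact: expR_itv_sub.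
  by rewrite /Rintegral (integral_expR_itv n cf dF).
move=> /cvg_lim <- //; apply: cvg_lim => //; exact: cvgB.
Unshelve. all: by end_near. Qed.

End half_line.

(** * Elementary bounds for sin, cos and ln *)

Section trig_bounds.
Variable R : realType.
Implicit Types s u x y : R.

Lemma sqr_sin_le s : sin s ^+ 2 <= s ^+ 2.
Proof.
have h u : 0 <= u -> sin u ^+ 2 <= u ^+ 2.
  move=> u0; have [c _] := @MVT_segment R sin cos 0 u u0 (fun x _ => is_derive_sin x)
    (continuous_subspaceT (@continuous_sin R)).
  rewrite sin0 !subr0 => ->; rewrite exprMn -[leRHS]mul1r ler_wpM2r ?sqr_ge0//.
have [|s0] := leP 0 s; first exact: h.
by have := h (- s); rewrite sinN !sqrrN oppr_ge0; apply; exact: ltW.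
Qed.

Lemma cos_ge1B_sqr s : 1 - s ^+ 2 / 2 <= cos s.
Proof.
have -> : cos s = 1 - 2 * sin (s / 2) ^+ 2.
  rewrite {1}(_ : s = (s / 2) *+ 2) ?cos_mulr2n ?cos2sin2; first by ring.
  by rewrite mulr2n; field.
have := sqr_sin_le (s / 2); rewrite exprMn; lra.
Qed.

(** With h = ln x / 2 the bracket is (e^h - e^(-h))^2. The factor 4 comes from ln x = 2 h and the
    crude bound e^h - e^(-h) >= h for h >= 0, which follows from e^h >= 1 + h and e^(-h) <= 1. *)
Lemma sqr_ln_le x : 0 < x -> ln x ^+ 2 <= 4 * (x - 2 + x^-1).
Proof.
move=> x0; set h := ln x / 2.
have -> : ln x = 2 * h by rewrite /h; field.
have xe : x = expR h ^+ 2.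
  by rewrite -expRM_natl /h -[LHS]lnK//; congr expR; field.
have -> : x - 2 + x^-1 = (expR h - expR (- h)) ^+ 2.
  by rewrite xe expRN; have := expR_gt0 h; move: (expR h) => e e0; field; rewrite gt_eqF.
rewrite exprMn -natrX ler_wpM2l//.
have H u : 0 <= u -> u ^+ 2 <= (expR u - expR (- u)) ^+ 2.
  move=> u0; rewrite ler_pXn2r// ?nnegrE.
    by have := expR_ge1Dx u; have : expR (- u) <= 1; [rewrite expR_le1; lra|lra].
  by rewrite subr_ge0 ler_expR; lra.
have [|h0] := leP 0 h; first exact: H.
rewrite -[h ^+ 2]sqrrN -[X in _ <= X]sqrrN opprB.
by have := H (- h); rewrite opprK; apply; lra.
Qed.

Lemma cos_sin_le (A B s : R) : A * cos s + B * sin s <= Num.sqrt (A ^+ 2 + B ^+ 2).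
Proof.
rewrite (le_trans (ler_norm _))// -sqrtr_sqr ler_wsqrtr//.
have := sqr_ge0 (A * sin s - B * cos s).
rewrite -(mulr1 (A ^+ 2)) -(mulr1 (B ^+ 2)) -(cos2Dsin2 s); nra.
Qed.

End trig_bounds.

(** * The Gamma function on vertical lines *)

Section gamma_integrals.
Variable R : realType.
Local Notation mu := (@lebesgue_measure R).
Local Notation pos := (`]0, +oo[%classic : set R).
Implicit Types a t x : R.

Lemma is_derive_cmul_ln a x : 0 < x -> is_derive x 1 (fun y => a * ln y) (a / x).
Proof. by move=> x0; apply: is_derive_cmulf; exact: is_derive1_ln. Qed.

Lemma is_derive_powexp a b x : 0 < x ->
  is_derive x 1 (fun y => expR (a * ln y - b * y)) ((a / x - b) * expR (a * ln x - b * x)).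
Proof.
move=> x0; rewrite mulrC; apply: is_derive_compf.
apply: is_derive_subf; first exact: is_derive_cmul_ln.
by rewrite -{2}[b]mulr1; apply: is_derive_cmulf; exact: is_derive_id.
Qed.

Lemma is_derive_cos_ln t x : 0 < x ->
  is_derive x 1 (fun y => cos (t * ln y)) (- sin (t * ln x) * (t / x)).
Proof. by move=> x0; apply: is_derive_compf; exact: is_derive_cmul_ln. Qed.

Lemma is_derive_sin_ln t x : 0 < x ->
  is_derive x 1 (fun y => sin (t * ln y)) (cos (t * ln x) * (t / x)).
Proof. by move=> x0; apply: is_derive_compf; exact: is_derive_cmul_ln. Qed.

(** The modulus of the integrand of [GammaC] at a + it, in the same form with [expR] and [ln]; its
    argument is t ln x. *)
Definition gamma_weight a x := expR ((a - 1) * ln x - x).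

Lemma gamma_weight_gt0 a x : 0 < gamma_weight a x.
Proof. exact: expR_gt0. Qed.

Lemma gamma_weightS a x : 0 < x -> gamma_weight (a + 1) x = x * gamma_weight a x.
Proof.
move=> x0; rewrite /gamma_weight addrK -{3}[x]lnK// -expRD; congr expR; ring.
Qed.

Lemma continuous_gamma_weight a x : 0 < x -> {for x, continuous (gamma_weight a)}.
Proof.
move=> x0; have := is_derive_continuous (is_derive_powexp (a - 1) 1 x0).
rewrite (_ : (fun _ => _) = gamma_weight a)//; apply/funext => y.
by rewrite /gamma_weight mul1r.
Qed.

(** The bound is K times the derivative of -1/(1 + x^a), a bounded function, so the behaviour at 0
    and at infinity is controlled at once. *)
Lemma gamma_weight_le a : 0 < a -> exists K : R, forall x, 0 < x ->
  gamma_weight a x <= K * (a / x * expR (a * ln x) / (1 + expR (a * ln x)) ^+ 2).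
Proof.
(* [C] is (2a)^a: from ln y <= y at y = x/(2a) one gets x^a <= C e^(x/2), whence (1 + x^a)^2 <= (1 +
   C)^2 e^x. *)
move=> a0; set C := expR (a * ln (2 * a)); exists ((1 + C) ^+ 2 / a) => x x0.
set u := expR (a * ln x); have u0 : 0 < u := expR_gt0 _.
have -> : gamma_weight a x = u / x * expR (- x).
  have -> : x^-1 = expR (- ln x) by rewrite expRN lnK.
  by rewrite /gamma_weight/u -!expRD; congr expR; ring.
have uC : u <= C * expR (x / 2).
  rewrite /u /C -expRD ler_expR -lerBlDl -mulrBr.
  have : ln (x / (2 * a)) <= x / (2 * a) by apply/ltW/ln_sublinear; rewrite divr_gt0// mulr_gt0.
  rewrite ln_div ?posrE ?mulr_gt0// => /(ler_wpM2l (ltW a0)) /le_trans; apply.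
  rewrite le_eqVlt; apply/orP; left; apply/eqP; field; rewrite gt_eqF//.
have ex1 : 1 <= expR (x / 2) by rewrite -expR0 ler_expR divr_ge0// ltW.
have h : 1 + u <= (1 + C) * expR (x / 2) by rewrite mulrDl mul1r lerD.
have h2 : (1 + u) ^+ 2 <= (1 + C) ^+ 2 * expR x.
  have -> : expR x = expR (x / 2) ^+ 2 by rewrite -expRM_natl; congr expR; field.
  rewrite -exprMn ler_pXn2r// nnegrE; first by rewrite addr_ge0// ltW.
  by rewrite (le_trans _ h)// addr_ge0// ltW.
have -> : (1 + C) ^+ 2 / a * (a / x * u / (1 + u) ^+ 2) =
   u / x * ((1 + C) ^+ 2 / (1 + u) ^+ 2).
  by field; rewrite !gt_eqF// addr_gt0.
apply: ler_wpM2l; first by rewrite divr_ge0// ltW.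
rewrite ler_pdivlMr ?exprn_gt0 ?addr_gt0//.
by rewrite expRN mulrC ler_pdivrMr ?expR_gt0.
Qed.

Lemma integrable_gamma_weight a : 0 < a ->
  mu.-integrable pos (EFin \o gamma_weight a).
Proof.
move=> a0; have [K wK] := gamma_weight_le a0.
pose f x := a / x * expR (a * ln x) / (1 + expR (a * ln x)) ^+ 2.
pose F x := - (1 + expR (a * ln x))^-1.
have dexp x : 0 < x -> is_derive x 1 (fun y => expR (a * ln y)) (a / x * expR (a * ln x)).
  move=> x0; have := is_derive_powexp a 0 x0.
  rewrite subr0 mul0r subr0 (_ : (fun _ => _) = fun y => expR (a * ln y))//.
  by apply/funext => y; rewrite mul0r subr0.
have p1 x : 1 + expR (a * ln x) != 0 by rewrite gt_eqF// addr_gt0// expR_gt0.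
have dF (x : R) : 0 < x -> is_derive x 1 F (f x).
  move=> x0; have d1 : is_derive x 1 (fun y => 1 + expR (a * ln y) : R) (a / x * expR (a * ln x)).
    by rewrite -[_ * _]add0r; apply: is_derive_addf (dexp x x0).
  rewrite -[f x]opprK; apply: is_derive_oppf.
  exact: (@is_derive_invf _ (fun y => 1 + expR (a * ln y))).
have cf (x : R) : 0 < x -> {for x, continuous f}.
  move=> x0; have ce := is_derive_continuous (dexp x x0).
  have c1 : {for x, continuous (fun y => 1 + expR (a * ln y) : R)}.
    by apply: continuousD => //; exact: cst_continuous.
  apply: (@continuousM R R (fun y => a / y * expR (a * ln y))
    (fun y => ((1 + expR (a * ln y)) ^+ 2)^-1)).
    apply: (@continuousM R R (fun y => a / y)) => //.
    apply: (@continuousM R R (fun y => a)); first exact: cst_continuous.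
    by apply: continuousV; rewrite ?gt_eqF.
  apply: continuousV; first by rewrite expf_neq0.
  exact: continuousM.
have fi : mu.-integrable pos (EFin \o f).
  apply: (@integrable_pos_is_derive _ f F 1) => //.
  - by move=> x x0; rewrite /f !mulr_ge0 ?invr_ge0 ?exprn_ge0 ?expR_ge0 ?ltW ?addr_gt0 ?expR_gt0.
  - move=> x x0; rewrite /F normrN normfV ger0_norm ?invf_le1 ?addr_ge0 ?expR_ge0 ?addr_gt0 ?expR_gt0//.
    by rewrite lerDl expR_ge0.
apply: (le_integrable _ _ _ (integrableZl _ K fi)) => //.
- by apply/measurable_EFinP; apply: measurable_fun_pos => x; exact: continuous_gamma_weight.
- move=> x; rewrite /= in_itv/= andbT => x0; rewrite lee_fin ger0_norm ?expR_ge0//.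
  exact: (le_trans (wK x x0) (ler_norm _)).
Qed.

End gamma_integrals.

Section gamma_transform.
Variable R : realType.
Local Notation mu := (@lebesgue_measure R).
Local Notation pos := (`]0, +oo[%classic : set R).
Implicit Types a t x : R.

Definition gamma_re a t := Rintegral mu pos (fun x => gamma_weight a x * cos (t * ln x)).
Definition gamma_im a t := Rintegral mu pos (fun x => gamma_weight a x * sin (t * ln x)).
Definition gamma_real a := Rintegral mu pos (gamma_weight a).

Lemma integrable_gammaM a (h : R -> R) (M : R) : 0 < a -> measurable_fun pos h ->
  (forall x, `|h x| <= M) ->
  mu.-integrable pos (EFin \o (fun x => gamma_weight a x * h x)).
Proof.
move=> a0 mh hM; apply: (integrableM_bounded _ (integrable_gamma_weight a0) mh) => //.
Qed.

Lemma continuous_cos_ln t x : 0 < x -> {for x, continuous (fun y => cos (t * ln y))}.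
Proof. by move=> x0; apply: is_derive_continuous; exact: is_derive_cos_ln. Qed.

Lemma continuous_sin_ln t x : 0 < x -> {for x, continuous (fun y => sin (t * ln y))}.
Proof. by move=> x0; apply: is_derive_continuous; exact: is_derive_sin_ln. Qed.

Lemma integrable_gamma_cos a t : 0 < a ->
  mu.-integrable pos (EFin \o (fun x => gamma_weight a x * cos (t * ln x))).
Proof.
move=> a0; apply: (@integrable_gammaM _ _ 1) => //; last by move=> x; exact: cos_max.
by apply: measurable_fun_pos => x; exact: continuous_cos_ln.
Qed.

Lemma integrable_gamma_sin a t : 0 < a ->
  mu.-integrable pos (EFin \o (fun x => gamma_weight a x * sin (t * ln x))).
Proof.
move=> a0; apply: (@integrable_gammaM _ _ 1) => //; last by move=> x; exact: sin_max.
by apply: measurable_fun_pos => x; exact: continuous_sin_ln.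
Qed.

(** The exponent is a n - e^n; since e^n >= n^2/2, completing the square in (a+1) n - n^2/2 bounds
    it by (a+1)^2/2 - n. *)
Lemma powexp_cvg0y a : expR (a * ln (expR n%:R) - expR n%:R) @[n --> \oo] --> (0 : R).
Proof.
apply: (@squeeze_cvgr _ _ _ _ (cst 0)
  (fun n : nat => expR ((a + 1) ^+ 2 / 2) * expR (- n%:R))).
- apply: nearW => n; rewrite expR_ge0/= expRK -expRD ler_expR.
  have := @expR_ge1Dxn R n%:R 1 (ler0n _ _); rewrite (_ : 2`!%:R = 2)//.
  have := sqr_ge0 (n%:R - (a + 1)); nra.
- exact: cvg_cst.
- rewrite -[X in _ --> X](mulr0 (expR ((a + 1) ^+ 2 / 2))).
  by apply: cvgMr; exact: cvgn_expR.
Qed.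

Lemma powexp_cvg00 a : 0 < a ->
  expR (a * ln (expR (- n%:R)) - expR (- n%:R)) @[n --> \oo] --> (0 : R).
Proof.
move=> a0; apply: (@squeeze_cvgr _ _ _ _ (cst 0) (fun n : nat => expR (- a) ^+ n)).
- apply: nearW => n; rewrite expR_ge0/= expRK -expRM_natl ler_expR mulrN mulrN mulrC.
  by rewrite lerBlDr lerDl expR_ge0.
- exact: cvg_cst.
- by apply: cvg_expr; rewrite ger0_norm ?expR_ge0// expR_lt1 oppr_lt0.
Qed.

Lemma cvg_mul_bounded (u v : nat -> R) : u n @[n --> \oo] --> 0 ->
  (forall n, `|v n| <= 1) -> u n * v n @[n --> \oo] --> 0.
Proof.
move=> u0 v1; apply: norm_cvg0.
apply: (@squeeze_cvgr _ _ _ _ (cst 0) (fun n => `|u n|)); last 2 first.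
- exact: cvg_cst.
- by rewrite -(normr0 R); exact: cvg_norm.
by apply: nearW => n; rewrite normr_ge0/= normrM ler_piMr.
Qed.

Lemma Rintegral_gamma_combo a t (A B : R) : 0 < a ->
  Rintegral mu pos (fun x => A * (gamma_weight a x * cos (t * ln x)) +
    B * (gamma_weight a x * sin (t * ln x))) = A * gamma_re a t + B * gamma_im a t.
Proof.
move=> a0; have i1 := integrable_gamma_cos t a0; have i2 := integrable_gamma_sin t a0.
rewrite RintegralD//; last 2 first.
- exact: integrableZr_EFin.
- exact: integrableZr_EFin.
by rewrite !RintegralZl.
Qed.

Lemma gamma_realE a : gamma_re a 0 = gamma_real a.
Proof. by apply: eq_Rintegral => x _; rewrite mul0r cos0 mulr1. Qed.

Lemma gamma_im0 a : gamma_im a 0 = 0.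
Proof.
rewrite /gamma_im (@eq_Rintegral _ _ _ _ _ (cst 0)) ?Rintegral_cst ?mul0r//.
by move=> x _; rewrite mul0r sin0 mulr0.
Qed.

(** Integration by parts: integrate the derivative of x^a e^(-x) h(x), whose values at both ends of
    the half-line vanish. Writing h' as [dh x / x] fits h = cos (t ln x) and h = sin (t ln x), for
    which [dh] is bounded. *)
Lemma Rintegral_gamma_weight_derive a (h dh : R -> R) (M : R) : 0 < a ->
  (forall x, 0 < x -> is_derive x 1 h (dh x / x)) ->
  (forall x, 0 < x -> {for x, continuous dh}) ->
  (forall x, `|h x| <= 1) -> (forall x, `|dh x| <= M) ->
  Rintegral mu pos (fun x => gamma_weight (a + 1) x * h x) =
    a * Rintegral mu pos (fun x => gamma_weight a x * h x) +
    Rintegral mu pos (fun x => gamma_weight a x * dh x).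
Proof.
move=> a0 Dh cdh h1 dh1.
have ch x : 0 < x -> {for x, continuous h} by move=> /Dh; exact: is_derive_continuous.
have mh := measurable_fun_pos ch; have mdh := measurable_fun_pos cdh.
have a10 : 0 < a + 1 by rewrite addr_gt0.
have i0 := integrable_gammaM a10 mh h1.
have i1 := integrable_gammaM a0 mh h1.
have i2 := integrable_gammaM a0 mdh dh1.
pose F x := expR (a * ln x - 1 * x) * h x.
pose f x := a * (gamma_weight a x * h x) + gamma_weight a x * dh x -
  gamma_weight (a + 1) x * h x.
have i3 : mu.-integrable pos (EFin \o
    (fun x => a * (gamma_weight a x * h x) + gamma_weight a x * dh x)).
  by apply: integrableDr => //; exact: integrableZr_EFin.
have : Rintegral mu pos f = 0 - 0.
  apply: (@Rintegral_pos_is_derive _ f F).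
  - move=> x x0; apply: (@continuousB R R R); last first.
      apply: (@continuousM R R); last exact: ch.
      exact: continuous_gamma_weight.
    apply: (@continuousD R R R); last first.
      apply: (@continuousM R R); last exact: cdh.
      exact: continuous_gamma_weight.
    apply: (@continuousM R R (fun=> a)); first exact: cst_continuous.
    apply: (@continuousM R R); last exact: ch.
    exact: continuous_gamma_weight.
  - move=> x x0; have dF := is_derive_mulf (is_derive_powexp a 1 x0) (Dh x x0).
    apply: is_derive_eq; rewrite /f !gamma_weightS//.
    have -> : expR (a * ln x - 1 * x) = x * gamma_weight a x.
      by rewrite mul1r -gamma_weightS// /gamma_weight addrK.
    by field; rewrite gt_eqF.
  - exact: integrableBr.
  - apply: cvg_mul_bounded => //.
    by under eq_fun do rewrite mul1r; exact: powexp_cvg00.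
  - apply: cvg_mul_bounded => //.
    by under eq_fun do rewrite mul1r; exact: powexp_cvg0y.
rewrite /f RintegralB// RintegralD//; last exact: integrableZr_EFin.
by rewrite RintegralZl// => /eqP; rewrite subrr subr_eq0 => /eqP <-.
Qed.

(** With [gamma_imS], these are the two components of Gamma(z+1) = z Gamma(z) at z = a + it. *)
Lemma gamma_reS a t : 0 < a -> gamma_re (a + 1) t = a * gamma_re a t - t * gamma_im a t.
Proof.
move=> a0; rewrite [LHS](@Rintegral_gamma_weight_derive _ _
  (fun x => - t * sin (t * ln x)) `|t| a0).
- congr (_ + _); rewrite -mulNr -RintegralZl//; last exact: integrable_gamma_sin.
  by apply: eq_Rintegral => x _; rewrite mulrCA.
- move=> x x0; have := is_derive_cos_ln t x0; congr (is_derive _ _ _ _); ring.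
- move=> x x0; apply: (@continuousM R R (fun=> - t)); first exact: cst_continuous.
  exact: continuous_sin_ln.
- by move=> x; exact: cos_max.
- by move=> x; rewrite normrM normrN ler_piMr// sin_max.
Qed.

Lemma gamma_imS a t : 0 < a -> gamma_im (a + 1) t = a * gamma_im a t + t * gamma_re a t.
Proof.
move=> a0; rewrite [LHS](@Rintegral_gamma_weight_derive _ _
  (fun x => t * cos (t * ln x)) `|t| a0).
- congr (_ + _); rewrite -RintegralZl//; last exact: integrable_gamma_cos.
  by apply: eq_Rintegral => x _; rewrite mulrCA.
- move=> x x0; have := is_derive_sin_ln t x0; congr (is_derive _ _ _ _); ring.
- move=> x x0; apply: (@continuousM R R (fun=> t)); first exact: cst_continuous.
  exact: continuous_cos_ln.
- by move=> x; exact: sin_max.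
- by move=> x; rewrite normrM ler_piMr// cos_max.
Qed.

Lemma gamma_realS a : 0 < a -> gamma_real (a + 1) = a * gamma_real a.
Proof. by move=> a0; rewrite -!gamma_realE gamma_reS// mul0r subr0. Qed.

Definition gamma_sqr a t := gamma_re a t ^+ 2 + gamma_im a t ^+ 2.

Lemma gamma_sqrS a t : 0 < a -> gamma_sqr (a + 1) t = (a ^+ 2 + t ^+ 2) * gamma_sqr a t.
Proof. by move=> a0; rewrite /gamma_sqr gamma_reS// gamma_imS//; ring. Qed.

Lemma gamma_real_gt0 a : 0 < a -> 0 < gamma_real a.
Proof.
move=> a0; have fi := integrable_gamma_weight a0.
(* A lower bound of the weight on [1, 2], where 0 <= ln x <= 1 and x <= 2. *)
pose c := expR (- `|a - 1| - 2).
have c0 : 0 < c := expR_gt0 _.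
rewrite -lte_fin /gamma_real /Rintegral fineK ?integrable_fin_num//.
have sub : `[1, 2]%classic `<=` pos.
  by move=> x /=; rewrite !in_itv/= andbT => /andP[x1 _]; rewrite (lt_le_trans _ x1).
have : (\int[mu]_(x in `[1%R, 2%R]) c%:E <= \int[mu]_(x in pos) (gamma_weight a x)%:E)%E.
  apply: (@le_trans _ _ (\int[mu]_(x in `[1%R, 2%R]) (gamma_weight a x)%:E)%E).
    apply: ge0_le_integral => //.
    - by move=> x _; rewrite lee_fin ltW.
    - exact: measurable_funS (measurable_int mu fi).
    - move=> x; rewrite /= in_itv/= => /andP[x1 x2].
      rewrite lee_fin ler_expR; apply: lerB => //.
      rewrite lerNl (le_trans (ler_norm _))// normrN normrM ler_piMr//.
      have x0 : 0 < x by rewrite (lt_le_trans _ x1).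
      rewrite ger0_norm ?ln_ge0//.
      have := @le_ln1Dx R (x - 1); rewrite subrKC; lra.
  apply: ge0_subset_integral => //; first exact: (measurable_int mu fi).
  by move=> x _; rewrite lee_fin ltW// gamma_weight_gt0.
rewrite integral_cst//= lebesgue_measure_itv/= lte_fin ltr1n -EFinD -EFinM.
apply: lt_le_trans; rewrite lte_fin mulr_gt0//; lra.
Qed.

(** Projecting the integral on its own direction gives S = |Gamma(a+it)|^2 as one real integral, and
    Cauchy-Schwarz under the integral sign bounds it by sqrt S times Gamma(a). *)
Lemma gamma_sqr_le a t : 0 < a -> gamma_sqr a t <= gamma_real a ^+ 2.
Proof.
move=> a0; have G0 := gamma_real_gt0 a0.
set S := gamma_sqr a t; have S0 : 0 <= S by rewrite addr_ge0 ?sqr_ge0.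
have : S <= Num.sqrt S * gamma_real a.
  have SE : S = gamma_re a t * gamma_re a t + gamma_im a t * gamma_im a t.
    by rewrite /S /gamma_sqr; ring.
  rewrite {1}SE -(Rintegral_gamma_combo t (gamma_re a t) (gamma_im a t) a0).
  rewrite -RintegralZl//; last exact: integrable_gamma_weight.
  apply: le_Rintegral => //.
  - by apply: integrableDr => //; apply: integrableZr_EFin => //;
      [exact: integrable_gamma_cos|exact: integrable_gamma_sin].
  - by apply: integrableZr_EFin => //; exact: integrable_gamma_weight.
  - move=> x _; rewrite !(mulrCA _ (gamma_weight _ _)) -mulrDr mulrC ler_wpM2r//.
      by rewrite ltW// gamma_weight_gt0.
    exact: cos_sin_le.
have [->|Sn0] := eqVneq S 0; first by rewrite sqr_ge0.
have sS : 0 < Num.sqrt S by rewrite sqrtr_gt0 lt_neqAle eq_sym Sn0.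
move: sS (sqr_sqrtr S0); set r := Num.sqrt S => r0 <-.
rewrite {1}expr2 ler_pM2l// => rG.
by rewrite ler_pXn2r// nnegrE ltW.
Qed.

(* The modulus dominates the component of Gamma(a+it) in the direction a^(it).
   As the weight concentrates near x = a, that component is bounded below by
   cos s >= 1 - s^2/2 with s = t ln (x/a) and ln u ^+ 2 <= 4 (u - 2 + 1/u),
   which only involves Gamma(a-1), Gamma(a), Gamma(a+1). *)
Lemma gamma_sqr_ge a t : 1 < a -> 2 * t ^+ 2 <= a - 1 ->
  gamma_real a ^+ 2 * (1 - 2 * t ^+ 2 / (a - 1)) ^+ 2 <= gamma_sqr a t.
Proof.
move=> a1 ta; have a0 : 0 < a by lra.
have a10 : 0 < a - 1 by lra.
have G0 := gamma_real_gt0 a0.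
pose A := cos (t * ln a); pose B := sin (t * ln a).
have : gamma_real a * (1 - 2 * t ^+ 2 / (a - 1)) <= A * gamma_re a t + B * gamma_im a t.
  (* The bracket is the integral of the weight against u - 2 + 1/u with u = x/a; the functional
     equation evaluates it to Gamma(a)/(a-1). *)
  have -> : gamma_real a * (1 - 2 * t ^+ 2 / (a - 1)) =
     gamma_real a - (2 * t ^+ 2) * (a^-1 * gamma_real (a + 1) - 2 * gamma_real a + a * gamma_real (a - 1)).
    have := gamma_realS a10; rewrite subrK => ->.
    rewrite gamma_realS// (_ : gamma_real a = (a - 1) * gamma_real (a - 1)); last first.
      by rewrite -{1}(subrK 1 a) gamma_realS.
    by field; rewrite !gt_eqF.
  have i0 := integrable_gamma_weight a0.
  have i1 := integrable_gamma_weight (addr_gt0 a0 ltr01).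
  have i2 := integrable_gamma_weight a10.
  have mpos : measurable (pos : set (measurableTypeR R)) by exact: measurable_itv.
  have j1 := integrableZr_EFin mpos a^-1 i1.
  have j2 := integrableZr_EFin mpos a i2.
  have j0 := integrableZr_EFin mpos 2 i0.
  have k1 := integrableBr mpos j1 j0.
  have k2 := integrableDr mpos k1 j2.
  have k3 := integrableZr_EFin mpos (2 * t ^+ 2) k2.
  have k4 := integrableBr mpos i0 k3.
  rewrite -(Rintegral_gamma_combo t A B a0).
  rewrite /gamma_real -!RintegralZl// -RintegralB// -RintegralD// -RintegralZl// -RintegralB//.
  apply: le_Rintegral => //.
    by apply: integrableDr => //; apply: integrableZr_EFin => //;
      [exact: integrable_gamma_cos|exact: integrable_gamma_sin].
  move=> x; rewrite /= in_itv/= andbT => x0.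
  have wx : gamma_weight a x = x * gamma_weight (a - 1) x by rewrite -gamma_weightS// subrK.
  rewrite -!/(gamma_weight _ x) gamma_weightS//.
  have -> : A * (gamma_weight a x * cos (t * ln x)) + B * (gamma_weight a x * sin (t * ln x)) =
      gamma_weight a x * cos (t * ln (x / a)).
    by rewrite ln_div// mulrBr cosB /A /B; ring.
  have -> : gamma_weight (a - 1) x = gamma_weight a x / x by rewrite wx; field; rewrite gt_eqF.
  have w0 := gamma_weight_gt0 a x.
  have -> : gamma_weight a x - 2 * t ^+ 2 * (a^-1 * (x * gamma_weight a x) - 2 * gamma_weight a x +
      a * (gamma_weight a x / x)) =
      gamma_weight a x * (1 - 2 * t ^+ 2 * (x / a - 2 + (x / a)^-1)).
    by field; rewrite !gt_eqF.
  apply: (ler_wpM2l (ltW w0)); apply: le_trans (cos_ge1B_sqr _).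
  apply: lerB => //; rewrite exprMn.
  have xa0 : 0 < x / a by rewrite divr_gt0.
  have := ler_wpM2l (sqr_ge0 t) (sqr_ln_le xa0).
  by set u := _ - 2 + _; lra.
set L := _ * (1 - _) => hL.
have L0 : 0 <= L by rewrite mulr_ge0 ?(ltW G0)// subr_ge0 ler_pdivrMr// mul1r.
rewrite -exprMn -/L (@le_trans _ _ ((A * gamma_re a t + B * gamma_im a t) ^+ 2))//.
  by rewrite ler_pXn2r ?nnegrE//; exact: le_trans hL.
have AB : A ^+ 2 + B ^+ 2 = 1 := cos2Dsin2 _.
have -> : gamma_sqr a t = (A * gamma_re a t + B * gamma_im a t) ^+ 2 +
    (A * gamma_im a t - B * gamma_re a t) ^+ 2.
  by rewrite /gamma_sqr -[LHS]mul1r -AB; ring.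
by rewrite lerDl sqr_ge0.
Qed.

End gamma_transform.

(** * Nonvanishing of Gamma and exponential decay of the quotient for two exponents *)

Section gamma_ratio.
Variable R : realType.
Implicit Types a p q t : R.

Definition gamma_ratio a t := gamma_sqr a t / gamma_real a ^+ 2.

Lemma gamma_ratioS a t : 0 < a ->
  gamma_ratio a t = a ^+ 2 / (a ^+ 2 + t ^+ 2) * gamma_ratio (a + 1) t.
Proof.
move=> a0; rewrite /gamma_ratio gamma_sqrS// gamma_realS//.
have G0 := gamma_real_gt0 a0; field.
rewrite !gt_eqF//= ltr_pwDl ?exprn_gt0 ?sqr_ge0//.
Qed.

Lemma gamma_ratio_le1 a t : 0 < a -> gamma_ratio a t <= 1.
Proof.
by move=> a0; rewrite ler_pdivrMr ?exprn_gt0 ?gamma_real_gt0// mul1r gamma_sqr_le.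
Qed.

(** The hypothesis keeps 2 t^2/(a-1) below 1/2, and 1/4 is the square of what remains. *)
Lemma gamma_ratio_ge a t : 1 + 4 * t ^+ 2 < a -> 1 / 4 <= gamma_ratio a t.
Proof.
move=> ta; have t20 := sqr_ge0 t; have a1 : 1 < a by lra.
have a10 : 0 < a - 1 by lra.
have G0 : 0 < gamma_real a by apply: gamma_real_gt0; lra.
rewrite ler_pdivlMr ?exprn_gt0// (le_trans _ (gamma_sqr_ge a1 _))//; last by lra.
rewrite mulrC ler_wpM2l ?sqr_ge0//.
have : 2 * t ^+ 2 / (a - 1) <= 1 / 2 by rewrite ler_pdivrMr//; lra.
set u := _ / (a - 1); move=> u2; have -> : 1 / 4 = (1 / 2) ^+ 2 :> R by field.
rewrite ler_pXn2r ?nnegrE//; lra.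
Qed.

(** The factor a^2/(a^2 + s^2) of [gamma_ratioS] at a = 1/p + k and s = t/p, with numerator and
    denominator multiplied by p^2; in this form two exponents are compared at the same t. *)
Definition gamma_factor p t (k : nat) := (1 + k%:R * p) ^+ 2 / ((1 + k%:R * p) ^+ 2 + t ^+ 2).

Lemma gamma_ratio_prod p t N : 0 < p ->
  gamma_ratio p^-1 (t / p) =
  (\prod_(k < N) gamma_factor p t k) * gamma_ratio (p^-1 + N%:R) (t / p).
Proof.
move=> p0; elim: N => [|N IH]; first by rewrite big_ord0 mul1r addr0.
have pN : 0 < p^-1 + N%:R by rewrite ltr_wpDr// invr_gt0.
rewrite IH big_ord_recr/= -mulrA (gamma_ratioS _ pN).
rewrite -natr1 addrA; congr (_ * (_ * _)); rewrite /gamma_factor.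
have N0 : 0 < 1 + N%:R * p by rewrite ltr_wpDr// mulr_ge0// ltW.
field; rewrite !gt_eqF//=.
by rewrite ltr_wpDr ?sqr_ge0// exprn_gt0.
Qed.

Lemma gamma_factor_gt0 p t k : 0 < p -> 0 < gamma_factor p t k.
Proof.
move=> p0; have k0 : 0 < 1 + k%:R * p by rewrite ltr_wpDr// mulr_ge0// ltW.
by rewrite divr_gt0 ?exprn_gt0// ltr_wpDr ?sqr_ge0// exprn_gt0.
Qed.

(** This is the nonvanishing of Gamma on a vertical line: after enough shifts the remainder is at
    least 1/4, and the finitely many factors split off are positive. *)
Lemma gamma_ratio_gt0 p t : 0 < p -> 0 < gamma_ratio p^-1 (t / p).
Proof.
move=> p0; pose N := (Num.trunc (1 + 4 * (t / p) ^+ 2)).+1.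
have Nt : 1 + 4 * (t / p) ^+ 2 < N%:R := truncnS_gt _.
rewrite (gamma_ratio_prod _ N)// mulr_gt0//.
  by apply: prodr_gt0 => k _; exact: gamma_factor_gt0.
apply: lt_le_trans (gamma_ratio_ge _) => //.
by rewrite (lt_trans Nt)// ltrDr invr_gt0.
Qed.

Section two_exponents.
Variables p q : R.
Hypotheses (p0 : 0 < p) (pq : p < q).

Let q0 : 0 < q. Proof. exact: lt_trans pq. Qed.

Lemma gamma_factor_le t k : gamma_factor p t k <= gamma_factor q t k.
Proof.
have a0 : 0 < 1 + k%:R * p by rewrite ltr_wpDr// mulr_ge0// ltW.
have ab : 1 + k%:R * p <= 1 + k%:R * q by rewrite lerD// ler_wpM2l// ltW.
rewrite /gamma_factor; set a := _ + _ in a0 ab *; set b := _ + _ * q in ab *.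
have b0 := lt_le_trans a0 ab.
have A0 : 0 < a ^+ 2 by rewrite exprn_gt0.
have AB : a ^+ 2 <= b ^+ 2 by rewrite ler_pXn2r// nnegrE ltW.
have T0 := sqr_ge0 t.
move: (a ^+ 2) (b ^+ 2) (t ^+ 2) A0 AB T0 => A B T A0 AB T0.
rewrite ler_pdivrMr ?ltr_wpDr// mulrAC ler_pdivlMr ?ltr_wpDr//; last exact: lt_le_trans AB.
rewrite !mulrDr (mulrC B A) lerD2l; exact: ler_wpM2r.
Qed.

(** With r the square, the extreme case A = r B, T = B of the quotient of factors A/(A+T) and
    B/(B+T) is 2r/(1+r), and this is at most (1+r)/2 < 1. *)
Let c := (1 + ((1 + p) / (1 + q)) ^+ 2) / 2.

Let rho_lt1 : ((1 + p) / (1 + q)) ^+ 2 < 1.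
Proof.
have p1 : 0 < 1 + p by rewrite addr_gt0.
have q1 : 0 < 1 + q by rewrite addr_gt0.
by rewrite expr_lt1 ?divr_ge0 ?(ltW p1) ?(ltW q1)// ltr_pdivrMr// mul1r ltrD2l.
Qed.

Let c_gt0 : 0 < c.
Proof. by rewrite divr_gt0// ltr_wpDr ?sqr_ge0. Qed.

Let c_lt1 : c < 1.
Proof. by rewrite /c; have := rho_lt1; set r := _ ^+ 2; lra. Qed.

Lemma gamma_factor_le_contract t k : (0 < k)%N -> 1 + k%:R * q <= `|t| ->
  gamma_factor p t k <= c * gamma_factor q t k.
Proof.
move=> k0 kt.
have p1 : 0 < 1 + p by rewrite addr_gt0.
have q1 : 0 < 1 + q by rewrite addr_gt0.
have a0 : 0 < 1 + k%:R * p by rewrite ltr_wpDr// mulr_ge0// ltW.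
(* The quotient (1+kp)/(1+kq) decreases in k; this is where k >= 1 enters. *)
have ab : 1 + k%:R * p <= (1 + p) / (1 + q) * (1 + k%:R * q).
  rewrite mulrAC ler_pdivlMr//.
  have : (q - p) * 1 <= (q - p) * k%:R by rewrite ler_wpM2l ?ler1n ?subr_ge0 ?(ltW pq).
  nra.
have b0 : 0 < 1 + k%:R * q by rewrite ltr_wpDr// mulr_ge0// ltW.
rewrite /gamma_factor; set a := _ + _ in a0 ab *; set b := _ + _ * q in kt ab b0 *.
have rr := rho_lt1; rewrite /c.
have A0 : 0 < a ^+ 2 by rewrite exprn_gt0.
have B0 : 0 < b ^+ 2 by rewrite exprn_gt0.
have AB : a ^+ 2 <= ((1 + p) / (1 + q)) ^+ 2 * b ^+ 2.
  rewrite -exprMn ler_pXn2r// nnegrE ?(ltW a0)//.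
  by rewrite mulr_ge0 ?(ltW b0)// divr_ge0 ?(ltW p1) ?(ltW q1).
have BT : b ^+ 2 <= t ^+ 2.
  by rewrite -(real_normK (num_real t)) ler_pXn2r// nnegrE ltW.
have r0 := sqr_ge0 ((1 + p) / (1 + q)).
move: (a ^+ 2) (b ^+ 2) (t ^+ 2) (((1 + p) / (1 + q)) ^+ 2) A0 AB BT B0 r0 rr => A B T r A0 AB BT B0 r0 r1.
have AT0 : 0 < A + T by lra.
have BT0 : 0 < B + T by lra.
rewrite ler_pdivrMr// mulrA mulrAC ler_pdivlMr//.
(* Twice the difference of the two sides is this product plus twice the next one. *)
have h1 : 0 <= (1 - r) * (B * (T - A)).
  by rewrite !mulr_ge0//; nra.
have h2 : 0 <= (r * B - A) * T by rewrite mulr_ge0//; lra.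
nra.
Qed.

(** The factors k = 1, ..., m each contribute [c]; factor 0, which explains [m.+1], and the last [M]
    ones are only compared. *)
Lemma prod_gamma_factor_le t m M :
  (forall k, (0 < k <= m)%N -> 1 + k%:R * q <= `|t|) ->
  \prod_(k < m.+1 + M) gamma_factor p t k <=
  c ^+ m * \prod_(k < m.+1 + M) gamma_factor q t k.
Proof.
move=> mt; elim: M => [|M IH]; last first.
  rewrite addnS; move: (m.+1 + M)%N IH => N IH.
  rewrite !big_ord_recr/= mulrA; apply: ler_pM => //.
  - by apply: prodr_ge0 => k _; exact/ltW/gamma_factor_gt0.
  - exact/ltW/gamma_factor_gt0.
  - exact: gamma_factor_le.
rewrite addn0; elim: m mt => [|m IH] mt.
  by rewrite expr0 mul1r !big_ord1 gamma_factor_le.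
rewrite big_ord_recr [in leRHS]big_ord_recr/= exprSr mulrACA; apply: ler_pM => //.
- by apply: prodr_ge0 => k _; exact/ltW/gamma_factor_gt0.
- exact/ltW/gamma_factor_gt0.
- by apply: IH => k /andP[k0 km]; apply: mt; rewrite k0 ltnW.
- by apply: gamma_factor_le_contract => //; apply: mt; rewrite /= leqnn.
Qed.

(** The extra [M] factors serve to bring the remainder for [q] above 1/4, while the one for [p] is
    at most 1; this gives the constant 4, and [M] drops out of the bound. *)
Lemma gamma_ratio_le_pow t m :
  (forall k, (0 < k <= m)%N -> 1 + k%:R * q <= `|t|) ->
  gamma_ratio p^-1 (t / p) <= 4 * c ^+ m * gamma_ratio q^-1 (t / q).
Proof.
move=> mt; pose M := (Num.trunc (1 + 4 * (t / q) ^+ 2)).+1.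
have Mt : 1 + 4 * (t / q) ^+ 2 < M%:R := truncnS_gt _.
rewrite (gamma_ratio_prod t (m.+1 + M) p0) (gamma_ratio_prod t (m.+1 + M) q0).
have h1 : gamma_ratio (p^-1 + (m.+1 + M)%:R) (t / p) <= 1.
  by rewrite gamma_ratio_le1// ltr_wpDr// invr_gt0.
have h2 : 1 / 4 <= gamma_ratio (q^-1 + (m.+1 + M)%:R) (t / q).
  apply: gamma_ratio_ge; rewrite (lt_le_trans Mt)// natrD addrA lerDr.
  by rewrite addr_ge0// invr_ge0 ltW.
have h3 := prod_gamma_factor_le M mt.
have P0 : 0 <= \prod_(k < m.+1 + M) gamma_factor p t k.
  by apply: prodr_ge0 => k _; exact/ltW/gamma_factor_gt0.
rewrite (le_trans (ler_piMr P0 h1))// (le_trans h3)//.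
have Q0 : 0 <= c ^+ m * \prod_(k < m.+1 + M) gamma_factor q t k by exact: le_trans h3.
move: (\prod_(k < m.+1 + M) gamma_factor q t k) Q0 => Q Q0.
have := ler_wpM2l Q0 h2; lra.
Qed.

Lemma gamma_ratio_le_expR : exists2 l : R, 0 < l &
  exists2 K : R, 0 < K & forall t,
  gamma_ratio p^-1 (t / p) <= K * expR (- l * `|t|) * gamma_ratio q^-1 (t / q).
Proof.
have lc : ln c < 0 by rewrite ln_lt0// c_gt0.
(* The rate and the constant are read off from c^m <= c^((|t|-1)/q - 1). *)
exists (- ln c / q); first by rewrite divr_gt0// oppr_gt0.
exists (4 * expR (- (q^-1 + 1) * ln c)); first by rewrite mulr_gt0// expR_gt0.
(* The largest [m] with 1 + m q <= |t|; the maximum yields m = 0 when |t| < 1. *)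
move=> t; pose x := Num.max 0 ((`|t| - 1) / q); pose m := Num.trunc x.
have x0 : 0 <= x by rewrite le_max lexx.
have /andP[mx xm] := truncn_itv x0; rewrite -/m in mx xm.
apply: (le_trans (@gamma_ratio_le_pow t m _)).
  move=> k /andP[k0 km]; have kx : k%:R <= x by rewrite (le_trans _ mx)// ler_nat.
  have : 0 < x by rewrite (lt_le_trans _ kx)// ltr0n.
  move: kx; rewrite /x /Num.max; case: ifPn => // _; last by rewrite ltxx.
  by rewrite ler_pdivlMr// lerBrDl.
rewrite ler_wpM2r//; first exact/ltW/gamma_ratio_gt0.
rewrite -mulrA ler_wpM2l// -expRD -[c in leLHS]lnK// -expRM_natl ler_expR.
have tx : (`|t| - 1) / q <= x by rewrite le_max lexx orbT.
have : (`|t| - 1) / q - 1 <= m%:R by move: xm; rewrite -natr1; lra.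
move=> /(ler_wnM2r (ltW lc)) /le_trans; apply.
rewrite le_eqVlt; apply/orP; left; apply/eqP; field; rewrite gt_eqF//.
Qed.

End two_exponents.

End gamma_ratio.

(** * Fourier inversion *)

(** Uniqueness on intervals compares two measures, so the set function given by a candidate density
    must first be one. *)
Lemma density_measure_exists d (T : measurableType d) (R : realType)
    (mu : {measure set T -> \bar R}) (f : T -> R) :
  measurable_fun setT f -> (forall x, 0 <= f x) ->
  exists nu : {measure set T -> \bar R},
    forall A, measurable A -> nu A = (\int[mu]_(x in A) (f x)%:E)%E.
Proof.
move=> mf f0; pose nu A := (\int[mu]_(x in A) (f x)%:E)%E.
have nu0 : nu set0 = 0%E by rewrite /nu integral_set0.
have nu_ge0 A : (0 <= nu A)%E by apply: integral_ge0 => x _; rewrite lee_fin.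
have nu_sigma : semi_sigma_additive nu.
  move=> F mF tF mUF; apply: cvg_toP.
    apply: ereal_nondecreasing_is_cvgn => m n mn.
    by apply: lee_sum_nneg_natr => // k _ _; exact: nu_ge0.
  rewrite /nu ge0_integral_bigcup//= => [|x _]; last by rewrite lee_fin.
  by apply/measurable_EFinP; exact: measurable_funTS.
pose m : {measure set T -> \bar R} :=
  HB.pack nu (isMeasure.Build _ _ _ nu nu0 nu_ge0 nu_sigma).
by exists m.
Qed.

Section densities.
Context d (T : measurableType d) (R : realType) (P : probability T R).
Variables (X : T -> R) (f : R -> R).
Hypotheses (mX : measurable_fun setT X).
Hypotheses (mf : measurable_fun setT f) (f0 : forall x, 0 <= f x).
Local Notation mu := (@lebesgue_measure R).

Lemma has_density_itvoc :
  (forall a b : R, a < b ->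
    P (X @^-1` `]a, b]) = (\int[mu]_(x in `]a, b]) (f x)%:E)%E) ->
  has_density P X f.
Proof.
move=> Xab; split => // A mA.
have [nu nuE] := @density_measure_exists _ (measurableTypeR R) R mu f mf f0.
have mX' : measurable_fun [set: T] (X : T -> measurableTypeR R) by [].
rewrite -nuE//.
apply: (@eq_measure_itvoc _ (pushforward P (X : T -> measurableTypeR R)) nu) => //.
  change (P (X @^-1` setT) < +oo)%E.
  by rewrite preimage_setT probability_setT ltry.
by move=> a b ab; rewrite nuE//; exact: Xab.
Qed.

Lemma has_density_pos :
  P (X @^-1` `]-oo, 0]) = 0%E -> (forall x, x <= 0 -> f x = 0) ->
  (forall a b : R, 0 < a -> a < b ->
    P (X @^-1` `]a, b]) = (\int[mu]_(x in `]a, b]) (f x)%:E)%E) ->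
  has_density P X f.
Proof.
move=> X0 f00 Xab; split => // A mA.
have [nu nuE] := @density_measure_exists _ (measurableTypeR R) R mu f mf f0.
have mX' : measurable_fun [set: T] (X : T -> measurableTypeR R) by [].
rewrite -nuE//.
apply: (@eq_measure_pos _ (pushforward P (X : T -> measurableTypeR R)) nu) => //.
- change (P (X @^-1` setT) < +oo)%E.
  by rewrite preimage_setT probability_setT ltry.
- rewrite nuE// integral0_eq// => x; rewrite /= in_itv/= => x0; by rewrite f00.
- by move=> a b a0 ab; rewrite nuE//; exact: Xab.
Qed.

Lemma has_density_ge0_expectation (h : R -> \bar R) : has_density P X f ->
  measurable_fun setT h -> (forall x, (0 <= h x)%E) ->
  (\int[P]_w h (X w) = \int[mu]_x (h x * (f x)%:E))%E.
Proof.
move=> [_ _ Xf] mh h0.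
have mX' : measurable_fun [set: T] (X : T -> measurableTypeR R) by [].
rewrite -(@ge0_integral_density _ (measurableTypeR R) R
  (pushforward P (X : T -> measurableTypeR R)) mu f h)//.
by rewrite ge0_integral_pushforward//= preimage_setT.
Qed.

End densities.

(** A bound that depends on the second variable alone and is integrable there makes [f] integrable
    on the product, as [m1] is finite. *)
Lemma Rintegral_Fubini d1 d2 (T1 : measurableType d1) (T2 : measurableType d2)
    (R : realType) (m1 : {finite_measure set T1 -> \bar R})
    (m2 : {sigma_finite_measure set T2 -> \bar R}) (f : T1 -> T2 -> R) (g : T2 -> R) :
  measurable_fun setT (fun z : T1 * T2 => f z.1 z.2) ->
  m2.-integrable setT (EFin \o g) ->
  (forall x y, `|f x y| <= g y) ->
  Rintegral m1 setT (fun x => Rintegral m2 setT (f x)) =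
  Rintegral m2 setT (fun y => Rintegral m1 setT (f ^~ y)).
Proof.
move=> mf gi fg.
have mf' : measurable_fun setT (fun z : T1 * T2 => (f z.1 z.2)%:E).
  exact/measurable_EFinP.
have fi2 x : m2.-integrable setT (fun y => (f x y)%:E).
  apply: (le_integrable measurableT _ _ gi).
    apply/measurable_EFinP.
    exact: (measurableT_comp mf (measurable_pair1 x)).
  by move=> y _; rewrite /= lee_fin (le_trans (fg x y))// ler_norm.
have fi1 y : m1.-integrable setT (fun x => (f x y)%:E).
  apply: (le_integrable measurableT _ _ (finite_measure_integrable_cst m1 (g y) measurableT)).
    apply/measurable_EFinP.
    exact: (measurableT_comp mf (measurable_pair2 y)).
  by move=> x _; rewrite /= lee_fin (le_trans (fg x y))// ler_norm.
have fi : (m1 \x m2)%E.-integrable setT (fun z => (f z.1 z.2)%:E).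
  apply/integrable12ltyP => //=.
  apply: (@le_lt_trans _ _ (\int[m1]_x (\int[m2]_y `|(g y)%:E|))%E).
    apply: ge0_le_integral => //.
    - by move=> x _; apply: integral_ge0.
    - apply: (measurable_fun_fubini_tonelli_F (fun z => `|(f z.1 z.2)%:E|)%E) => //.
      exact: measurableT_comp.
    - move=> x _; apply: ge0_le_integral => //.
      + exact: (measurable_int m2 (integrable_abse (fi2 x))).
      + exact: (measurable_int m2 (integrable_abse gi)).
      + by move=> y _; rewrite lee_fin (le_trans (fg x y))// ler_norm.
  have /integrableP[_ goo] := gi.
  rewrite integral_cst// lte_mul_pinfty ?integral_ge0// ?ltey_eq ?fin_num_measure//.
  by rewrite ge0_fin_numE// integral_ge0.
rewrite /Rintegral; congr fine; transitivity (\int[m1]_x (\int[m2]_y (f x y)%:E))%E.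
  by apply: eq_integral => x _; rewrite fineK// integrable_fin_num.
rewrite (Fubini fi); apply: eq_integral => x _.
by rewrite fineK// integrable_fin_num.
Qed.

(** * The Poisson kernel as the transform of e^(-e |t|) *)

Section poisson_kernel.
Variable R : realType.
Local Notation mu := (@lebesgue_measure R).
Implicit Types e t y : R.

Lemma cvg_expR_mulN e : 0 < e -> expR (- e * t) @[t --> +oo] --> (0 : R).
Proof.
move=> e0; rewrite (_ : (fun t => expR (- e * t)) =
  (fun z => expR (- z)) \o (fun z => e * z)); last first.
  by apply/funext => x /=; rewrite mulNr.
apply: (@cvg_comp _ _ _ _ _ _ (pinfty_nbhs R)); last exact: cvgr_expR.
exact: gt0_cvgMry.
Qed.

Lemma is_derive_expR_mul e t : is_derive t 1 (fun s => expR (- e * s)) (- e * expR (- e * t)).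
Proof.
rewrite mulrC; apply: is_derive_compf.
by rewrite -{2}[- e]mulr1; apply: is_derive_cmulf; exact: is_derive_id.
Qed.

Lemma is_derive_mulr_id y t : is_derive t 1 (fun s : R => s * y) y.
Proof.
have := is_derive_cmulf (is_derive_id t (1 : R)) y.
by rewrite mulr1 (_ : (fun _ => _) = fun s => s * y)//; apply/funext => s; rewrite mulrC.
Qed.

Lemma continuous_1Dcos y : continuous (fun t : R => 1 + cos (t * y) : R).
Proof.
move=> t; apply: (@continuousD R R R (fun=> 1)); first exact: cst_continuous.
apply: (@continuous_comp R R R (fun t : R => t * y)); last exact: continuous_cos.
apply: (@continuousM R R id) => //; exact: cst_continuous.
Qed.

Lemma continuous_laplace e y :
  continuous (fun t : R => expR (- e * `|t|) * (1 + cos (t * y)) : R).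
Proof.
move=> t; apply: (@continuousM R R (fun t => expR (- e * `|t|))).
  apply: (@continuous_comp R R R (fun t : R => - e * `|t|)); last exact: continuous_expR.
  apply: (@continuousM R R (fun=> - e)); first exact: cst_continuous.
  exact: norm_continuous.
exact: continuous_1Dcos.
Qed.

(** Adding 1 to the cosine makes the integrand nonnegative, so that symmetry and the improper
    fundamental theorem apply without prior integrability; the cosine alone is recovered later by
    subtracting the integral of e^(-e |t|). *)
Lemma integral_laplace1Dcos e y : 0 < e ->
  (\int[mu]_t (expR (- e * `|t|) * (1 + cos (t * y)))%:E =
   (2 / e + 2 * e / (e ^+ 2 + y ^+ 2))%:E)%E.
Proof.
move=> e0; have ey0 : 0 < e ^+ 2 + y ^+ 2 by rewrite ltr_wpDr ?sqr_ge0// exprn_gt0.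
have f0 (t : R) : 0 <= 1 + cos (t * y) by have := cos_geN1 (t * y); lra.
rewrite ge0_symfun_integralT; last 3 first.
- by move=> t; rewrite mulr_ge0// expR_ge0.
- exact: continuous_laplace.
- by move=> t /=; rewrite normrN (mulNr t) cosN.
rewrite -set_itvcy.
(* The antiderivative on [0, +oo[ that tends to 0 at infinity, so the integral is -F(0). *)
pose F t := expR (- e * t) * (- e^-1 + (y * sin (t * y) - e * cos (t * y)) / (e ^+ 2 + y ^+ 2)).
have dF t : is_derive t 1 F (expR (- e * t) * (1 + cos (t * y))).
  have ds : is_derive t 1 (fun s => sin (s * y)) (cos (t * y) * y).
    by apply: is_derive_compf; exact: is_derive_mulr_id.
  have dc : is_derive t 1 (fun s => cos (s * y)) (- sin (t * y) * y).
    by apply: is_derive_compf; exact: is_derive_mulr_id.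
  have d1 := is_derive_subf (is_derive_cmulf ds y) (is_derive_cmulf dc e).
  have d2 := is_derive_addf (is_derive_cst (- e^-1) t 1)
    (is_derive_mulf d1 (is_derive_cst ((e ^+ 2 + y ^+ 2)^-1) t 1)).
  have d3 := is_derive_mulf (is_derive_expR_mul e t) d2.
  apply: is_derive_eq; rewrite /cst /=; field.
  by rewrite !gt_eqF.
have cF t : {for t, continuous F} by apply: is_derive_continuous; exact: dF.
transitivity (2%:E * \int[mu]_(t in `[0%R, +oo[) (expR (- e * t) * (1 + cos (t * y)))%:E)%E.
  congr (_ * _)%E; apply: eq_integral => t; rewrite inE/= in_itv/= andbT => t0.
  by rewrite ger0_norm.
rewrite (@ge0_continuous_FTC2y _ _ F 0 0).
- rewrite /F mulr0 expR0 mul0r sin0 cos0 mulr0 mulr1 mul1r -EFinD -EFinM.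
  by congr EFin; field; rewrite !gt_eqF.
- by move=> t _; rewrite mulr_ge0// expR_ge0.
- apply: continuous_subspaceT => t.
  apply: (@continuousM R R (fun t => expR (- e * t))); last exact: continuous_1Dcos.
  exact: is_derive_continuous (is_derive_expR_mul e t).
- pose C := e^-1 + (`|y| + e) / (e ^+ 2 + y ^+ 2).
  apply: norm_cvg0; apply: (@squeeze_cvgr _ _ _ _ (cst 0) (fun t => expR (- e * t) * C)).
  + apply: nearW => t; rewrite normr_ge0/= normrM ger0_norm ?expR_ge0//.
    rewrite ler_wpM2l ?expR_ge0// (le_trans (ler_normD _ _))// normrN ger0_norm ?invr_ge0 ?(ltW e0)//.
    rewrite lerD2l normrM [X in _ * X]ger0_norm ?invr_ge0 ?(ltW ey0)// ler_wpM2r ?invr_ge0 ?(ltW ey0)//.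
    rewrite (le_trans (ler_normB _ _))// !normrM (ger0_norm (ltW e0)) lerD//.
      by rewrite ler_piMr// sin_max.
    by rewrite ler_piMr ?(ltW e0)// cos_max.
  + exact: cvg_cst.
  + rewrite -(mul0r C); apply: cvgMl; exact: cvg_expR_mulN.
- by move=> t _; have [] := dF t.
- exact/cvg_at_right_filter/cF.
- by move=> t _; rewrite derive1E; have [] := dF t.
Qed.

Lemma integral_expR_norm e : 0 < e ->
  (\int[mu]_t (expR (- e * `|t|))%:E = (2 / e)%:E)%E.
Proof.
move=> e0; have := integral_laplace1Dcos 0 e0.
under eq_integral do rewrite mulr0 cos0 mulrC EFinM.
have mE : measurable_fun setT (fun t : R => (expR (- e * `|t|))%:E).
  apply/measurable_EFinP; apply: continuous_measurable_fun => t.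
  apply: (@continuous_comp R R R (fun t : R => - e * `|t|)); last exact: continuous_expR.
  apply: (@continuousM R R (fun=> - e)); first exact: cst_continuous.
  exact: norm_continuous.
rewrite ge0_integralZl//.
move=> H; have : ((1 + 1)%:E * \int[mu]_x (expR (- e * `|x|))%:E =
  (1 + 1)%:E * (2 / e)%:E)%E.
  by rewrite H -EFinM; congr EFin; field; rewrite gt_eqF.
have two0 : (0 < (1 + 1 : R)%:E)%E by rewrite lte_fin; lra.
(* The factor 2 can be cancelled only for a finite value; the infinite ones contradict the
   equation. *)
case: (\int[_]_x _)%E => [r| |].
- by rewrite -!EFinM => -[] /mulfI ->//; rewrite gt_eqF//; lra.
- by rewrite gt0_muley.
- by rewrite gt0_muleNy.
Qed.

Lemma integrable_expR_norm e : 0 < e ->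
  mu.-integrable setT (fun t => (expR (- e * `|t|))%:E).
Proof.
move=> e0; apply/integrableP; split.
  apply/measurable_EFinP; apply: continuous_measurable_fun => t.
  apply: (@continuous_comp R R R (fun t : R => - e * `|t|)); last exact: continuous_expR.
  apply: (@continuousM R R (fun=> - e)); first exact: cst_continuous.
  exact: norm_continuous.
under eq_integral do rewrite gee0_abs ?lee_fin ?expR_ge0//.
by rewrite integral_expR_norm// ltry.
Qed.

Lemma Rintegral_laplace_cos e y : 0 < e ->
  Rintegral mu setT (fun t => expR (- e * `|t|) * cos (t * y)) = 2 * e / (e ^+ 2 + y ^+ 2).
Proof.
move=> e0; have i0 := integrable_expR_norm e0.
have m1 : measurable_fun [set: R] (fun t : R => 1 + cos (t * y)).
  by apply: continuous_measurable_fun; exact: continuous_1Dcos.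
have i1 : mu.-integrable setT (EFin \o (fun t => expR (- e * `|t|) * (1 + cos (t * y)))).
  apply: (integrableM_bounded measurableT i0 _ (M := 2)).
    exact: m1.
  move=> t _; rewrite (le_trans (ler_normD _ _))// normr1.
  by have := cos_max (t * y); lra.
transitivity (Rintegral mu setT (fun t => expR (- e * `|t|) * (1 + cos (t * y)) - expR (- e * `|t|))).
  by apply: eq_Rintegral => t _; ring.
rewrite RintegralB//.
by rewrite /Rintegral integral_laplace1Dcos// integral_expR_norm//= addrAC subrr add0r.
Qed.

End poisson_kernel.

Lemma measurable_cosf d (T : measurableType d) (R : realType) (f : T -> R) :
  measurable_fun setT f -> measurable_fun setT (fun w => cos (f w)).
Proof.
move=> mf; apply: (measurableT_comp _ mf).
by apply: continuous_measurable_fun; exact: continuous_cos.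
Qed.

Lemma measurable_sinf d (T : measurableType d) (R : realType) (f : T -> R) :
  measurable_fun setT f -> measurable_fun setT (fun w => sin (f w)).
Proof.
move=> mf; apply: (measurableT_comp _ mf).
by apply: continuous_measurable_fun; exact: continuous_sin.
Qed.

Section fourier_integrals.
Variable R : realType.
Local Notation mu := (@lebesgue_measure R).
Local Notation RT := (measurableTypeR R).
Variables A B : R -> R.
Hypotheses (iA : mu.-integrable setT (EFin \o A)) (iB : mu.-integrable setT (EFin \o B)).

(** The real part of e^(-ity) (A(t) + i B(t)). *)
Definition fourier_integrand (y t : R) : R := cos (t * y) * A t + sin (t * y) * B t.

Definition inverse_fourier (y : R) : R :=
  (2 * pi)^-1 * Rintegral mu setT (fourier_integrand y).

Let M (t : R) : R := `|A t| + `|B t|.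

Lemma fourier_integrand_le y t : `|fourier_integrand y t| <= `|A t| + `|B t|.
Proof.
rewrite (le_trans (ler_normD _ _))// !normrM lerD// ler_piMl//.
  exact: cos_max.
exact: sin_max.
Qed.

Lemma integrable_fourier_bound : mu.-integrable setT (EFin \o M).
Proof. by apply: integrableDr => //; exact: integrable_norm. Qed.

Lemma measurable_fourier_integrand y : measurable_fun [set: RT] (fourier_integrand y).
Proof.
have m1 : measurable_fun [set: RT] (fun t : R => t * y).
  exact: (@measurable_funM _ RT R setT id (cst y)).
apply: measurable_funD; apply: measurable_funM.
- exact: measurable_cosf.
- by apply/measurable_EFinP; exact: (measurable_int mu iA).
- exact: measurable_sinf.
- by apply/measurable_EFinP; exact: (measurable_int mu iB).
Qed.

Lemma integrable_fourier_integrand y : mu.-integrable setT (EFin \o fourier_integrand y).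
Proof.
apply: (le_integrable measurableT _ _ integrable_fourier_bound).
  by apply/measurable_EFinP; exact: measurable_fourier_integrand.
by move=> t _; rewrite /= lee_fin (le_trans (fourier_integrand_le y t))// ler_norm.
Qed.

Lemma inverse_fourier_le y : inverse_fourier y <= (2 * pi)^-1 * Rintegral mu setT M.
Proof.
rewrite ler_wpM2l//; first by rewrite invr_ge0 mulr_ge0// pi_ge0.
apply: le_Rintegral => //.
- exact: integrable_fourier_integrand.
- exact: integrable_fourier_bound.
- by move=> t _; rewrite (le_trans (ler_norm _))// fourier_integrand_le.
Qed.

Lemma continuous_inverse_fourier : continuous inverse_fourier.
Proof.
rewrite -[inverse_fourier]/(fun y => (2 * pi)^-1 * Rintegral mu setT (fourier_integrand y)) => y.
apply: (@continuousM R R (fun=> (2 * pi)^-1)); first exact: cst_continuous.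
have : {in `]y - 1, y + 1[%classic, continuous (fun l => Rintegral mu setT (fourier_integrand l))}.
  apply: (@continuity_under_integral R _ RT mu fourier_integrand setT measurableT _ _ _ _ M) => //.
  - by move=> x _; exact: integrable_fourier_integrand.
  - apply: aeW => t _ x _.
    apply: (@continuousD R R R (fun y => cos (t * y) * A t)).
      apply: (@continuousM R R); last exact: cst_continuous.
      apply: (@continuous_comp R R R (fun y : R => t * y)); last exact: continuous_cos.
      apply: (@continuousM R R (fun=> t)) => //; exact: cst_continuous.
    apply: (@continuousM R R); last exact: cst_continuous.
    apply: (@continuous_comp R R R (fun y : R => t * y)); last exact: continuous_sin.
    apply: (@continuousM R R (fun=> t)) => //; exact: cst_continuous.
  - exact: integrable_fourier_bound.
  - by move=> x _; apply: aeW => t _; exact: fourier_integrand_le.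
apply; rewrite inE/= in_itv/=; apply/andP; split; lra.
Qed.

End fourier_integrals.

(** * Inversion for a random variable with integrable characteristic function *)

Section fourier_inversion.
Context d (T : measurableType d) (R : realType) (P : probability T R).
Variable (Y : T -> R).
Hypothesis (mY : measurable_fun setT Y).
Local Notation mu := (@lebesgue_measure R).
Local Notation RT := (measurableTypeR R).

Definition char_cos (t : R) : R := Rintegral P setT (fun w => cos (t * Y w)).
Definition char_sin (t : R) : R := Rintegral P setT (fun w => sin (t * Y w)).
Local Notation inversion_integrand := (fourier_integrand char_cos char_sin).
Local Notation inversion_density := (inverse_fourier char_cos char_sin).

Lemma integrable_bounded_RV (f : T -> R) (M : R) : measurable_fun setT f ->
  (forall w, `|f w| <= M) -> P.-integrable setT (EFin \o f).
Proof.
move=> mf fM; apply: (le_integrable measurableT _ _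
  (finite_measure_integrable_cst P M measurableT)).
  exact/measurable_EFinP.
by move=> w _; rewrite /= lee_fin (le_trans (fM w))// ler_norm.
Qed.

(** The subtraction formula merges e^(-ity) with the characteristic function, so that t multiplies
    the single variable Y - y. *)
Lemma fourier_integrand_charE y t :
  inversion_integrand y t = Rintegral P setT (fun w => cos (t * (Y w - y))).
Proof.
have mtY : measurable_fun setT (fun w => t * Y w) by exact: measurable_funM.
have ic : P.-integrable setT (EFin \o (fun w => cos (t * Y w))).
  by apply: (integrable_bounded_RV (M := 1)) (measurable_cosf mtY) _ => w; exact: cos_max.
have is' : P.-integrable setT (EFin \o (fun w => sin (t * Y w))).
  by apply: (integrable_bounded_RV (M := 1)) (measurable_sinf mtY) _ => w; exact: sin_max.
rewrite /fourier_integrand /char_cos /char_sin -!RintegralZl// -RintegralD//; last 2 first.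
- exact: integrableZr_EFin.
- exact: integrableZr_EFin.
by apply: eq_Rintegral => w _; rewrite mulrBr cosB; ring.
Qed.

Hypothesis integrable_cos : mu.-integrable setT (EFin \o char_cos).
Hypothesis integrable_sin : mu.-integrable setT (EFin \o char_sin).

Let B (t : R) : R := `|char_cos t| + `|char_sin t|.

Let integrable_B : mu.-integrable setT (EFin \o B) :=
  integrable_fourier_bound integrable_cos integrable_sin.

Let integrand_le y t : `|inversion_integrand y t| <= B t :=
  fourier_integrand_le char_cos char_sin y t.

Let measurable_integrand y : measurable_fun [set: RT] (inversion_integrand y) :=
  measurable_fourier_integrand integrable_cos integrable_sin y.

Let integrable_integrand y : mu.-integrable setT (EFin \o inversion_integrand y) :=
  integrable_fourier_integrand integrable_cos integrable_sin y.

Let e n : R := n.+1%:R^-1.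
Let e_gt0 n : 0 < e n. Proof. by rewrite invr_gt0. Qed.

(* The regularized inversion integral, a Poisson average by [gaE]. *)
Let ga n (y : R) : R := (2 * pi)^-1 * Rintegral mu setT (fun t => expR (- e n * `|t|) * inversion_integrand y t).

Let measurable_expR_norm n : measurable_fun [set: RT] (fun t : R => expR (- e n * `|t|)).
Proof.
apply/measurable_EFinP; exact: (measurable_int mu (integrable_expR_norm (e_gt0 n))).
Qed.

Let expR_norm_le1 n (t : R) : expR (- e n * `|t|) <= 1.
Proof. by rewrite expR_le1 mulNr oppr_le0 mulr_ge0// ltW. Qed.

Let twopi_ge0 : 0 <= (2 * pi : R)^-1.
Proof. by rewrite invr_ge0 mulr_ge0// pi_ge0. Qed.

Lemma cvg_ga y : ga n y @[n --> \oo] --> inversion_density y.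
Proof.
apply: cvgMr; apply: (@cvg_Rintegral_dominated _ RT R mu setT
  (fun n t => expR (- e n * `|t|) * inversion_integrand y t) (inversion_integrand y) B) => //.
- by move=> n; exact: measurable_funM.
- move=> t _; rewrite -[X in _ --> X]mul1r; apply: cvgMl.
  rewrite -expR0 -(mul0r `|t|) -oppr0.
  have et0 : - e n * `|t| @[n --> \oo] --> - 0 * `|t|.
    by apply: cvgMl; apply: cvgN; exact: cvg_harmonic.
  exact: (cvg_comp _ _ et0 (@continuous_expR R _)).
- move=> n t _; rewrite normrM ger0_norm ?expR_ge0//.
  by rewrite (le_trans _ (integrand_le y t))// ler_piMl.
Qed.

(** The Cauchy density of scale [e n]. *)
Let poisson n (x : R) : R := pi^-1 * (e n / (e n ^+ 2 + x ^+ 2)).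

Let poisson_den n (x : R) : 0 < e n ^+ 2 + x ^+ 2.
Proof. by rewrite ltr_wpDr ?sqr_ge0// exprn_gt0. Qed.

Let continuous_poisson n : continuous (poisson n).
Proof.
rewrite -[poisson n]/(fun x : R => pi^-1 * (e n / (e n ^+ 2 + x ^+ 2))) => x.
apply: (@continuousM R R (fun=> pi^-1) (fun x : R => e n / (e n ^+ 2 + x ^+ 2))); first exact: cst_continuous.
apply: (@continuousM R R (fun=> e n) (fun x : R => (e n ^+ 2 + x ^+ 2)^-1)); first exact: cst_continuous.
apply: continuousV; first by rewrite gt_eqF.
apply: (@continuousD R R R (fun=> e n ^+ 2) (fun x : R => x ^+ 2)); first exact: cst_continuous.
exact: (@continuousM R R id id).
Qed.

Let poisson_ge0 n x : 0 <= poisson n x.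
Proof. by rewrite mulr_ge0 ?invr_ge0 ?pi_ge0// divr_ge0// ltW. Qed.

Let poisson_le n x : poisson n x <= pi^-1 * (e n)^-1.
Proof.
rewrite /poisson ler_wpM2l ?invr_ge0 ?pi_ge0// ler_pdivrMr//.
rewrite mulrDr expr2 mulKf ?gt_eqF// lerDl mulr_ge0 ?sqr_ge0// invr_ge0 ltW//.
Qed.

(** The exponential weight is the dominating function that allows the exchange of integrals; a
    cosine alone is not integrable in t. *)
Lemma gaE n y : ga n y = Rintegral P setT (fun w => poisson n (Y w - y)).
Proof.
pose f (w : T) (t : RT) : R := expR (- e n * `|t|) * cos (t * (Y w - y)).
have mf : measurable_fun [set: T * RT] (fun z : T * RT => f z.1 z.2).
  apply: measurable_funM.
    exact: (measurableT_comp (measurable_expR_norm n) measurable_snd).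
  apply: measurable_cosf.
  apply: measurable_funM; first exact: measurable_snd.
  apply: measurable_funB => //; exact: (measurableT_comp mY measurable_fst).
have fB w t : `|f w t| <= expR (- e n * `|t|).
  by rewrite /f normrM ger0_norm ?expR_ge0// ler_piMr ?expR_ge0// cos_max.
have := Rintegral_Fubini P mf (integrable_expR_norm (e_gt0 n)) fB.
have -> : (fun t : RT => Rintegral P setT (f ^~ t)) =
    (fun t => expR (- e n * `|t|) * inversion_integrand y t).
  apply/funext => t; rewrite fourier_integrand_charE -RintegralZl//.
  apply: (integrable_bounded_RV (M := 1)); last by move=> w; exact: cos_max.
  by apply: measurable_cosf; apply: measurable_funM => //; exact: measurable_funB.
rewrite /ga => <-.
rewrite (@eq_Rintegral _ _ _ _ _ (fun w => 2 * pi * poisson n (Y w - y))); last first.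
  move=> w _; rewrite Rintegral_laplace_cos// /poisson.
  by rewrite -(mulrA 2 pi) mulVKf ?gt_eqF ?pi_gt0// mulrA.
rewrite RintegralZl//; last first.
  apply: (integrable_bounded_RV (M := pi^-1 * (e n)^-1)).
    apply: (measurableT_comp (continuous_measurable_fun (@continuous_poisson n))).
    exact: measurable_funB.
  by move=> w; rewrite ger0_norm.
by rewrite mulrA mulVf ?mul1r// mulf_neq0// gt_eqF// pi_gt0.
Qed.

Lemma inverse_fourier_char_ge0 y : 0 <= inversion_density y.
Proof.
rewrite -(cvg_lim _ (@cvg_ga y))//; apply: limr_ge; first exact: cvgP (@cvg_ga y).
by apply: nearW => n; rewrite gaE; apply: Rintegral_ge0 => w _; exact: poisson_ge0.
Qed.

Let measurable_poisson2 n : measurable_fun [set: T * RT] (fun z : T * RT => poisson n (Y z.1 - z.2)).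
Proof.
apply: (measurableT_comp (continuous_measurable_fun (@continuous_poisson n))).
apply: measurable_funB; last exact: measurable_snd.
exact: (measurableT_comp mY measurable_fst).
Qed.

Let measurable_ga n : measurable_fun [set: RT] (ga n).
Proof.
rewrite (_ : ga n = fun y => Rintegral P setT (fun w => poisson n (Y w - y))); last first.
  by apply/funext => y; rewrite gaE.
apply: (measurableT_comp (@fine_measurable R setT measurableT)).
apply: (measurable_fun_fubini_tonelli_G
  (fun z : T * RT => (poisson n (Y z.1 - z.2))%:E)) => //.
  by apply/measurable_EFinP; exact: measurable_poisson2.
by move=> z; rewrite lee_fin.
Qed.

Let M := (2 * pi)^-1 * Rintegral mu setT B.

Let ga_le n y : `|ga n y| <= M.
Proof.
rewrite /ga /M normrM ger0_norm// ler_wpM2l//.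
have fi : mu.-integrable setT (EFin \o (fun t => expR (- e n * `|t|) * inversion_integrand y t)).
  have := integrableM_bounded measurableT (integrable_integrand y) (measurable_expR_norm n).
  move=> /(_ 1) H; under eq_fun do rewrite mulrC; apply: H => t _.
  by rewrite ger0_norm ?expR_ge0.
apply: (le_trans (le_normr_Rintegral measurableT fi)).
apply: le_Rintegral => //; first exact: integrable_norm.
move=> t _; rewrite normrM ger0_norm ?expR_ge0//.
by rewrite (le_trans _ (integrand_le y t))// ler_piMl.
Qed.

Let patch_indicE (D : set R) (h : R -> R) : h \_ D = fun x => \1_D x * h x.
Proof.
by apply/funext => x; rewrite patchE indicE; case: ifP => _; rewrite ?mul1r ?mul0r.
Qed.

(** The integral of y |-> [poisson n (Y w - y)] over [a, b]. *)
Let atan_diff n (a b : R) w : R := pi^-1 * (atan ((b - Y w) / e n) - atan ((a - Y w) / e n)).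

Let is_derive_poisson n (x y : R) : is_derive y 1 (fun y => pi^-1 * atan ((y - x) / e n)) (poisson n (x - y)).
Proof.
have d1 : is_derive y 1 (fun y => (y - x) / e n) (e n)^-1.
  have := is_derive_cmulf (is_derive_subf (is_derive_id y (1 : R)) (is_derive_cst x y (1 : R))) (e n)^-1.
  by rewrite subr0 mulr1 (_ : (fun _ => _) = fun y => (y - x) / e n)//; apply/funext => z; rewrite mulrC.
have d2 : is_derive y 1 (fun y => atan ((y - x) / e n)) ((1 + ((y - x) / e n) ^+ 2)^-1 * (e n)^-1).
  by apply: is_derive_compf; exact: d1.
have := is_derive_cmulf d2 pi^-1; congr (is_derive _ _ _ _).
rewrite /poisson; congr (_ * _).
rewrite (_ : (x - y) ^+ 2 = (y - x) ^+ 2); last by ring.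
have := poisson_den n (y - x); have := e_gt0 n; move: (e n) (y - x) => s z s0 sz.
have : 1 + (z / s) ^+ 2 != 0 by rewrite gt_eqF// ltr_wpDr// sqr_ge0.
by move=> h; field; rewrite !gt_eqF.
Qed.

Let Rintegral_ga n a b : a <= b ->
  Rintegral mu `[a, b] (ga n) = Rintegral P setT (atan_diff n a b).
Proof.
move=> ab; rewrite Rintegral_mkcond patch_indicE.
pose f (w : T) (y : RT) : R := \1_(`[a, b]%classic : set R) y * poisson n (Y w - y).
have m1 : measurable_fun [set: RT] (\1_(`[a, b]%classic : set R) : R -> R).
  exact: measurable_indic.
have mf : measurable_fun [set: T * RT] (fun z : T * RT => f z.1 z.2).
  apply: measurable_funM; last exact: measurable_poisson2.
  exact: (measurableT_comp m1 measurable_snd).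
pose g (y : RT) : R := (pi^-1 * (e n)^-1) * \1_(`[a, b]%classic : set R) y.
have gi : mu.-integrable setT (EFin \o g).
  by apply: integrableZr_EFin => //; exact: integrable_indic_itv.
have fg w y : `|f w y| <= g y.
  by rewrite /f /g mulrC normrM (ger0_norm (poisson_ge0 _ _)) ger0_norm// ler_wpM2r.
have := Rintegral_Fubini P mf gi fg.
rewrite (_ : (fun y => Rintegral P setT (f ^~ y)) = fun y => \1_(`[a, b]%classic : set R) y * ga n y); last first.
  apply/funext => y; rewrite gaE -RintegralZl//.
  apply: (integrable_bounded_RV (M := pi^-1 * (e n)^-1)).
    apply: (measurableT_comp (continuous_measurable_fun (@continuous_poisson n))).
    exact: measurable_funB.
  by move=> w; rewrite ger0_norm.
move=> <-; apply: eq_Rintegral => w _.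
rewrite /f -patch_indicE -Rintegral_mkcond /Rintegral.
have -> : (\int[mu]_(y in `[a, b]) (poisson n (Y w - y))%:E =
    (pi^-1 * atan ((b - Y w) / e n) - pi^-1 * atan ((a - Y w) / e n))%:E)%E.
  apply: (@integral_is_derive R (fun y => poisson n (Y w - y))
    (fun y => pi^-1 * atan ((y - Y w) / e n))) => // y _.
  apply: (@continuous_comp R R R (fun y => Y w - y)); last exact: continuous_poisson.
  by apply: (@continuousB R R R) => //; exact: cst_continuous.
by rewrite -mulrBr.
Qed.

Let cvg_atan_sg (z : R) : atan (z / e n) @[n --> \oo] --> pi / 2 * Num.sg z.
Proof.
have pos (x : R) : 0 < x -> atan (x / e n) @[n --> \oo] --> (pi / 2 : R).
  move=> x0; apply: (cvg_comp (fun n => x / e n) atan _ (@cvgy_atan R)).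
  apply/cvgryPge => A; near=> n; rewrite /e invrK mulrC -ler_pdivrMr//.
  by apply: (@le_trans _ _ n%:R); [near: n; exact: nbhs_infty_ger|rewrite ler_nat].
have [z0|z0|->] := ltgtP z 0.
- rewrite ltr0_sg// mulrN1 (_ : (fun n => _) = fun n => - atan (- z / e n)); last first.
    by apply/funext => n; rewrite mulNr atanN opprK.
  by apply: cvgN; apply: pos; rewrite oppr_gt0.
- by rewrite gtr0_sg// mulr1; exact: pos.
- rewrite sgr0 mulr0 (_ : (fun n => _) = cst 0); first exact: cvg_cst.
  by apply/funext => n; rewrite mul0r atan0.
Unshelve. all: by end_near. Qed.

Let atan_diff_le n a b w : `|atan_diff n a b w| <= 1.
Proof.
have h (x : R) : `|atan x| <= pi / 2.
  by rewrite ler_norml (ltW (atan_gtNpi2 x)) (ltW (atan_ltpi2 x)).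
rewrite /atan_diff normrM ger0_norm ?invr_ge0 ?pi_ge0// mulrC ler_pdivrMr ?pi_gt0// mul1r.
rewrite (le_trans (ler_normB _ _))// (le_trans (lerD (h _) (h _)))//.
by rewrite -splitr.
Qed.

(* The indicator of a < Y < b, with value 1/2 at the endpoints when a < b. *)
Let jump (a b : R) w : R := (Num.sg (b - Y w) - Num.sg (a - Y w)) / 2.

Let measurable_atan_diff n a b : measurable_fun setT (atan_diff n a b).
Proof.
have h c : measurable_fun setT (fun w => atan ((c - Y w) / e n)).
  apply: (measurableT_comp (continuous_measurable_fun (@continuous_atan R))).
  apply: measurable_funM => //; exact: measurable_funB.
apply: measurable_funM => //; exact: measurable_funB.
Qed.

Let cvg_atan_diff a b w : atan_diff n a b w @[n --> \oo] --> jump a b w.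
Proof.
rewrite (_ : jump a b w = pi^-1 * (pi / 2 * Num.sg (b - Y w) - pi / 2 * Num.sg (a - Y w))).
  by apply: cvgMr; apply: cvgB; exact: cvg_atan_sg.
by rewrite /jump -mulrBr -!mulrA mulKf ?gt_eqF ?pi_gt0// mulrC.
Qed.

Let measurable_jump a b : measurable_fun setT (jump a b).
Proof.
apply: (measurable_fun_cvg (fun n => measurable_atan_diff n a b)) => w _.
exact: cvg_atan_diff.
Qed.

Let measurable_density : measurable_fun [set: RT] inversion_density.
Proof. exact: continuous_measurable_fun (continuous_inverse_fourier integrable_cos integrable_sin). Qed.

Let jump_le a b w : `|jump a b w| <= 1.
Proof.
rewrite /jump normrM [X in _ * X]ger0_norm// ler_pdivrMr// mul1r (le_trans (ler_normB _ _))//.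
by rewrite !normr_sg -[leRHS]/(1 + 1) lerD// lern1 leq_b1.
Qed.

(** Both sides are limits of the integrals of [ga n] over [a, b]: one by domination by the constant
    [M] on a bounded interval, the other after exchanging integrals, with domination by 1 on the
    probability space. *)
Let Rintegral_density a b : a <= b ->
  Rintegral mu `[a, b] inversion_density = Rintegral P setT (jump a b).
Proof.
move=> ab.
have c1 : Rintegral mu `[a, b] (ga n) @[n --> \oo] --> Rintegral mu `[a, b] inversion_density.
  apply: (@cvg_Rintegral_dominated _ RT R mu `[a, b] ga inversion_density (cst M)) => //.
  - by move=> n; apply: measurable_funTS; exact: measurable_ga.
  - by apply: measurable_funTS; exact: measurable_density.
  - by move=> y _; exact: cvg_ga.
  - apply: measurable_bounded_integrable => //.
      by rewrite /= lebesgue_measure_itv/=; case: ifP => _; rewrite ltry.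
    by exists `|M|; split => // x xM y _ /=; exact: ltW.
have c2 : Rintegral mu `[a, b] (ga n) @[n --> \oo] --> Rintegral P setT (jump a b).
  under eq_fun do rewrite (Rintegral_ga _ ab).
  apply: (@cvg_Rintegral_dominated _ T R P setT (fun n => atan_diff n a b) (jump a b) (cst 1)) => //.
  exact: finite_measure_integrable_cst.
by rewrite -(cvg_lim _ c1)// -(cvg_lim _ c2).
Qed.

Let integrable_density a b : mu.-integrable `[a, b] (EFin \o inversion_density).
Proof.
apply: measurable_bounded_integrable => //.
- by rewrite /= lebesgue_measure_itv/=; case: ifP => _; rewrite ltry.
- by apply: measurable_funTS; exact: measurable_density.
- exists M; split; first exact: num_real.
  move=> x Mx y _; rewrite /= ger0_norm ?inverse_fourier_char_ge0//.
  by rewrite (le_trans (inverse_fourier_le integrable_cos integrable_sin y))// ltW.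
Qed.

Let jump_ge0 a b w : a <= b -> 0 <= jump a b w.
Proof.
move=> ab; rewrite /jump divr_ge0// subr_ge0.
have ab' : a - Y w <= b - Y w by rewrite lerB.
have [a0|a0|a0] := ltgtP (a - Y w) 0.
- by rewrite (ltr0_sg a0); case: sgrP => _; lra.
- by rewrite !gtr0_sg// (lt_le_trans a0).
- by rewrite a0 sgr0 sgr_ge0 -a0.
Qed.

Let measurable_preimage (A : set R) : measurable A -> measurable (Y @^-1` A).
Proof. by move=> mA; rewrite -[X in measurable X]setTI; exact: mY. Qed.

Let integrable_jump a b : P.-integrable setT (EFin \o jump a b).
Proof. exact: integrable_bounded_RV (measurable_jump a b) (jump_le a b). Qed.

(** On Y = c the function [jump] of the interval of radius [dl] around c is 1, so the mass of the
    atom is at most its expectation, which is the integral of a density bounded by [M], hence at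
    most 2 [dl] [M]. *)
Let atomless c : P (Y @^-1` [set c]) = 0%E.
Proof.
have mc : measurable (Y @^-1` [set c]) by exact: measurable_preimage.
have M0 : 0 <= M.
  by rewrite mulr_ge0//; apply: Rintegral_ge0 => t _; rewrite addr_ge0.
suff h (x : R) : 0 < x -> fine (P (Y @^-1` [set c])) <= x.
  apply/eqP; rewrite -(@fineK _ (P _)) ?fin_num_measure// eqe eq_le fine_ge0// andbT.
  by apply/ler_addgt0Pl => x x0; rewrite addr0 h.
move=> x0.
have M1 : 0 < M + 1 by rewrite ltr_wpDl.
(* Dividing by [M + 1] also covers M = 0. *)
have [dl dl0 dlE] : exists2 dl : R, 0 < dl & 2 * dl = x / (M + 1).
  exists (x / (2 * (M + 1))); first by rewrite divr_gt0// mulr_gt0.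
  by rewrite invfM mulrCA mulVKf.
have ab : c - dl <= c + dl by rewrite lerD2l; lra.
have -> : fine (P (Y @^-1` [set c])) = Rintegral P setT (\1_(Y @^-1` [set c])).
  by rewrite /Rintegral integral_indic// setIT.
apply: (@le_trans _ _ (Rintegral P setT (jump (c - dl) (c + dl)))).
  apply: le_Rintegral => //; [exact: integrable_indic|exact: integrable_jump|].
  move=> w _; rewrite -/(jump (c - dl) (c + dl) w).
  case: (boolP (w \in Y @^-1` [set c])) => [|_] /=; last exact: jump_ge0.
  rewrite inE/= => wc; rewrite /jump wc.
  rewrite (addrAC c dl) (addrAC c (- dl)) subrr !add0r.
  by rewrite gtr0_sg// ltr0_sg ?oppr_lt0// opprK -[X in X / _]/(2 : R) divff.
rewrite -Rintegral_density//.
have fin : (mu (`[(c - dl)%R, (c + dl)%R]%classic : set R) < +oo)%E.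
  by rewrite /= lebesgue_measure_itv/=; case: ifP => _; rewrite ltry.
apply: (@le_trans _ _ (Rintegral mu `[c - dl, c + dl] (cst M))).
  apply: le_Rintegral => //; last by move=> y _; exact: (inverse_fourier_le integrable_cos integrable_sin).
  apply: measurable_bounded_integrable => //.
  by exists `|M|; split => // z zM y _ /=; exact: ltW.
rewrite Rintegral_cst// /= lebesgue_measure_itv/= lte_fin.
case: ifPn => _ /=; last by rewrite mulr0 ltW.
have -> : c + dl - (c - dl) = 2 * dl by clear; move: c dl => u v; ring.
rewrite dlE.
rewrite mulrCA -[leRHS]mulr1 ler_wpM2l ?(ltW x0)// ler_pdivrMr// mul1r lerDl//.
Qed.

(** On half-open intervals [jump a b] differs from the indicator only where Y is an endpoint, and
    this event is null since the law has no atoms. *)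
Lemma has_density_inversion : has_density P Y inversion_density.
Proof.
apply: has_density_itvoc => //.
  exact: inverse_fourier_char_ge0.
move=> a b ab; have mab : measurable (Y @^-1` `]a, b]) by exact: measurable_preimage.
rewrite integral_itv_obnd_cbnd; last first.
  by apply/measurable_EFinP; apply: measurable_funTS; exact: measurable_density.
have fin : (\int[mu]_(x in `[a, b]) (inversion_density x)%:E)%E \is a fin_num.
  by apply: integrable_fin_num => //; exact: integrable_density.
rewrite -[RHS]fineK//.
rewrite -[X in _ = X%:E]/(Rintegral mu `[a, b] inversion_density) (Rintegral_density (ltW ab)).
rewrite -[LHS]fineK ?fin_num_measure//; congr EFin.
have -> : fine (P (Y @^-1` `]a, b])) = Rintegral P setT (\1_(Y @^-1` `]a, b])).
  by rewrite /Rintegral integral_indic// setIT.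
rewrite /Rintegral; congr fine; apply: ae_eq_integral => //.
- by apply/measurable_EFinP; exact: measurable_indic.
- by apply/measurable_EFinP; exact: measurable_jump.
have m1 c : measurable (Y @^-1` [set c]) by exact: measurable_preimage.
exists (Y @^-1` [set a] `|` Y @^-1` [set b]); split.
- exact: measurableU.
- by rewrite measureU0//; exact: atomless.
move=> w /= H; apply: contrapT => /not_orP[/eqP wa /eqP wb]; apply: H => _.
congr EFin; rewrite indicE /jump.
have -> : (w \in Y @^-1` `]a, b]) = (a < Y w <= b).
  by apply/idP/idP; rewrite inE/= in_itv/=.
have [la|la|la] := ltgtP a (Y w); last by rewrite la eqxx in wa.
- rewrite (ltr0_sg (x := a - Y w)) ?subr_lt0//.
  have [lb|lb|lb] := ltgtP (Y w) b; last by rewrite lb eqxx in wb.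
  + by rewrite gtr0_sg ?subr_gt0// opprK -[X in X / _]/(2 : R) divff.
  + by rewrite ltr0_sg ?subr_lt0// subrr mul0r.
- rewrite !gtr0_sg ?subr_gt0 ?subrr ?mul0r//; exact: lt_trans ab.
Qed.

End fourier_inversion.

(** * The law of |X|^r / 2 *)

Section substitution.
Variable R : realType.
Local Notation mu := (@lebesgue_measure R).

(** Integrating from a point strictly between [l] and [a], up to beyond [b], makes the derivative
    two-sided at both endpoints. *)
Lemma antiderivative_exists (f : R -> R) (l a b : R) : l < a ->
  (forall x : R, l < x -> {for x, continuous f}) ->
  exists W : R -> R, forall x, a <= x <= b -> is_derive x 1 W (f x).
Proof.
move=> la cf; pose m := (l + a) / 2; have lm : l < m by rewrite /m; lra.
have ma : m < a by rewrite /m; lra.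
exists (fun x => Rintegral mu `[m, x] f) => x /andP[ax xb].
have xb1 : x < b + 1 by lra.
have fi : mu.-integrable `[m, b + 1] (EFin \o f).
  apply: continuous_compact_integrable; first exact: segment_compact.
  apply: continuous_in_subspaceT => y; rewrite inE/= in_itv/= => /andP[my _].
  by apply: cf; exact: lt_le_trans my.
have cfx : {for x, continuous f} by apply: cf; exact: lt_le_trans ax.
have [dW WE] := continuous_FTC1_closed xb1 fi (lt_le_trans ma ax) cfx.
by move: WE; rewrite derive1E => WE; exact: (DeriveDef dW WE).
Qed.

(** Both sides equal W(F b) - W(F a) for an antiderivative W of [f], defined on the whole range of
    [F]. *)
Lemma integral_substitution (f F dF : R -> R) (l a b : R) : a <= b -> l < F a ->
  (forall x : R, l < x -> {for x, continuous f}) ->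
  (forall x, a <= x <= b -> F a <= F x <= F b) ->
  (forall x, a <= x <= b -> is_derive x 1 F (dF x)) ->
  (forall x, a <= x <= b -> {for x, continuous dF}) ->
  (\int[mu]_(x in `[F a, F b]) (f x)%:E = \int[mu]_(x in `[a, b]) (f (F x) * dF x)%:E)%E.
Proof.
move=> ab lFa cf Fab DF cdF; have [W DW] := antiderivative_exists (F b) lFa cf.
have FaFb : F a <= F b.
  by have := Fab b; rewrite ab lexx => /(_ isT) /andP[].
rewrite (integral_is_derive FaFb _ DW)//; last first.
  by move=> x /andP[ax _]; apply: cf; exact: lt_le_trans ax.
apply/esym; apply: (@integral_is_derive _ _ (fun x => W (F x))) => // x xab.
- apply: (@continuousM R R (fun x => f (F x))); last exact: cdF.
  apply: (@continuous_comp R R R F).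
    exact: is_derive_continuous (DF x xab).
  by apply: cf; have /andP[+ _] := Fab x xab; exact: lt_le_trans.
- by apply: is_derive_compf; [exact: DF|apply: DW; exact: Fab].
Qed.

End substitution.

Lemma has_density_integrable d (T : measurableType d) (R : realType) (P : probability T R)
    (X : T -> R) (f : R -> R) : has_density P X f ->
  (@lebesgue_measure R).-integrable setT (EFin \o f).
Proof.
move=> [mf f0 Xf]; apply/integrableP; split; first exact/measurable_EFinP.
under eq_integral do rewrite /= ger0_norm//.
rewrite -Xf// -(_ : P setT = pushforward P X setT)//.
by rewrite probability_setT ltry.
Qed.

(** The nonnegative formula is applied to 1 + h and to 1; subtraction gives the signed [h]. *)
Lemma Rintegral_has_density d (T : measurableType d) (R : realType) (P : probability T R)
    (X : T -> R) (f h : R -> R) : measurable_fun setT X -> has_density P X f ->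
  measurable_fun setT h -> (forall x, `|h x| <= 1) ->
  Rintegral P setT (fun w => h (X w)) =
  Rintegral (@lebesgue_measure R) setT (fun x => h x * f x).
Proof.
move=> mX Xf mh h1; have [mf f0 _] := Xf.
have h0 x : 0 <= 1 + h x.
  by have := h1 x; rewrite ler_norml => /andP[? _]; lra.
have m1h : measurable_fun setT (fun x => (1 + h x)%:E).
  by apply/measurable_EFinP; exact: measurable_funD.
have := has_density_ge0_expectation mX mf f0 Xf m1h (fun x => h0 x).
have := has_density_ge0_expectation mX mf f0 Xf (measurable_cst 1%E) (fun=> lee01).
have fi := has_density_integrable Xf.
have hfi : (@lebesgue_measure R).-integrable setT (EFin \o (fun x => h x * f x)).
  have := integrableM_bounded measurableT fi mh (fun x _ => h1 x).
  by under eq_fun do rewrite mulrC.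
have hXi : P.-integrable setT (EFin \o (fun w => h (X w))).
  apply: (@integrable_bounded_RV _ _ _ P _ 1); last by move=> w; exact: h1.
  exact: measurableT_comp mh mX.
have P1 : P.-integrable setT (EFin \o (fun=> 1 : R)) by exact: finite_measure_integrable_cst.
move=> /(congr1 fine) E1 /(congr1 fine) E2.
have : Rintegral P setT (fun w => 1 + h (X w)) =
   Rintegral (@lebesgue_measure R) setT (fun x => f x + h x * f x).
  rewrite /Rintegral; transitivity (fine (\int[P]_w (1 + h (X w))%:E)%E) => //.
  rewrite E2; congr fine; apply: eq_integral => x _.
  by rewrite -EFinM mulrDl mul1r.
rewrite RintegralD// RintegralD//.
have -> : Rintegral P setT (fun=> 1) = Rintegral (@lebesgue_measure R) setT f.
  rewrite /Rintegral; transitivity (fine (\int[P]_w (cst 1%E) (X w))%E) => //.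
  by rewrite E1; congr fine; apply: eq_integral => x _; rewrite /cst mul1e.
by move=> /addrI.
Qed.

(** * The complex Gamma function in terms of its real and imaginary parts *)

Section complex_gamma.
Variable R : realType.
Local Open Scope complex_scope.
Implicit Types a t x : R.

Lemma expC_Complex a b : expC (a +i* b) = (expR a * cos b) +i* (expR a * sin b).
Proof. by rewrite /expC; simpc. Qed.

Lemma GammaC_Complex a t : GammaC (a +i* t) = gamma_re a t +i* gamma_im a t.
Proof.
rewrite /GammaC /integralC /gamma_re /gamma_im.
congr (_ +i* _); apply: eq_Rintegral => x _.
all: rewrite (_ : ((a +i* t - 1) * (ln x)%:C - x%:C) = ((a - 1) * ln x - x) +i* (t * ln x)); last by simpc; rewrite ?subr0.
all: by rewrite expC_Complex.
Qed.

Lemma GammaC_real a : GammaC a%:C = (gamma_real a)%:C.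
Proof. by rewrite (GammaC_Complex a 0) gamma_realE gamma_im0. Qed.

Lemma GammaC_line r t : GammaC ((1 +i* t) / r%:C) = gamma_re r^-1 (t / r) +i* gamma_im r^-1 (t / r).
Proof.
rewrite -GammaC_Complex; congr GammaC.
by rewrite -fmorphV; simpc.
Qed.

Lemma pow2iE r t : pow2i r t = cos (t / r * ln 2) +i* sin (t / r * ln 2).
Proof. by rewrite /pow2i expC_Complex expR0 !mul1r. Qed.

End complex_gamma.

Section gamma_pdf.
Variable R : realType.
Implicit Types a u : R.

Definition gamma_pdf a u : R := if 0 < u then gamma_weight a u / gamma_real a else 0.

Lemma gamma_pdf_ge0 a u : 0 < a -> 0 <= gamma_pdf a u.
Proof.
move=> a0; rewrite /gamma_pdf; case: ifPn => // _.
by rewrite divr_ge0 ?ltW ?gamma_weight_gt0 ?gamma_real_gt0.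
Qed.

Lemma gamma_pdfE a : gamma_pdf a = (fun u => gamma_weight a u / gamma_real a) \_ (`]0, +oo[%classic : set R).
Proof.
apply/funext => u; rewrite patchE /gamma_pdf.
have -> : (u \in (`]0, +oo[%classic : set R)) = (0 < u) by apply/idP/idP; rewrite inE/= in_itv/= andbT.
by [].
Qed.

Lemma measurable_gamma_pdf a : measurable_fun setT (gamma_pdf a).
Proof.
rewrite gamma_pdfE; apply: (iffLR (measurable_restrictT _ _)) => //.
apply: measurable_funM => //; apply: measurable_fun_pos => x; exact: continuous_gamma_weight.
Qed.

End gamma_pdf.

Section gnormal_law.
Context d (T : measurableType d) (R : realType) (P : probability T R).
Variables (X : T -> R) (r : R).
Hypotheses (r0 : 0 < r) (mX : measurable_fun setT X).
Hypothesis Xr : has_density P X (gnormal_pdf r).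
Local Notation mu := (@lebesgue_measure R).
Local Notation G := (gamma_real r^-1).

Let G0 : 0 < G. Proof. by rewrite gamma_real_gt0// invr_gt0. Qed.

(** This is x^r/2 on the positive axis, in a form that is easy to differentiate; it gives [U] at |X|
    only where X is nonzero, and it is positive everywhere by the default values of [ln]. *)
Let F (x : R) := expR (r * ln x) / 2.
Let f1 (x : R) := r / (2 `^ (1 + r^-1) * G) * expR (- F x).

Let gnormal_pdfE (x : R) : x != 0 -> gnormal_pdf r x = f1 `|x|.
Proof.
move=> x0; rewrite /gnormal_pdf GammaC_real/= /f1 /F.
by rewrite mulrC -{2}[r]mulr1 /powR normr_eq0 (negPf x0) mulr1 mulrC.
Qed.

Let dF (x : R) : 0 < x -> is_derive x 1 F (r / x * expR (r * ln x) / 2).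
Proof.
move=> x0; have := is_derive_cmulf (is_derive_powexp r 0 x0) 2^-1.
rewrite subr0 mul0r subr0 mulrC (_ : (fun _ => _) = F)//.
by apply/funext => y; rewrite mul0r subr0 mulrC.
Qed.

(** The Jacobian computation for u = x^r/2. The factor 2 reflects that x and -x have the same
    image. *)
Let f1E (x : R) : 0 < x ->
  gamma_weight r^-1 (F x) / G * (r / x * expR (r * ln x) / 2) = 2 * f1 x.
Proof.
move=> x0; rewrite /gamma_weight /f1.
have lnF : ln (F x) = r * ln x - ln 2 by rewrite ln_div ?posrE ?expR_gt0// expRK.
rewrite lnF (expRD ((r^-1 - 1) * _)).
have p2 : 2 `^ (1 + r^-1) = expR ((1 + r^-1) * ln 2) :> R by rewrite /powR pnatr_eq0.
rewrite p2 invfM -expRN.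
have xE : x^-1 = expR (- ln x) by rewrite expRN lnK.
have l2 : 2^-1 = expR (- ln 2) :> R by rewrite expRN lnK// posrE.
have l22 : 2 = expR (ln 2) :> R by rewrite lnK// posrE.
rewrite xE.
(* The powers of x cancel and those of 2 combine to 2^(-1/r). *)
have e1 : expR ((r^-1 - 1) * (r * ln x - ln 2)) * (expR (- ln x) * expR (r * ln x)) / 2 =
   2 * expR (- ((1 + r^-1) * ln 2)).
  rewrite {1}l2 {3}l22 -!expRD; congr expR; field; rewrite gt_eqF//.
rewrite -[LHS]/(_ * _ / _ * _).
transitivity (expR ((r^-1 - 1) * (r * ln x - ln 2)) * (expR (- ln x) * expR (r * ln x)) / 2 *
  (r * expR (- F x) / G)); first by ring.
by rewrite e1; ring.
Qed.

Let U w := `|X w| `^ r / 2.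

Let U_F w : X w != 0 -> U w = F `|X w|.
Proof. by move=> w0; rewrite /U /F /powR normr_eq0 (negPf w0). Qed.

Let U_0 w : X w = 0 -> U w = 0.
Proof. by move=> w0; rewrite /U w0 normr0 powR0 ?mul0r// gt_eqF. Qed.

Let U_gt0 w : X w != 0 -> 0 < U w.
Proof. by move=> w0; rewrite U_F// divr_gt0// expR_gt0. Qed.

Let mU : measurable_fun setT U.
Proof.
apply: measurable_funM => //; apply: (measurableT_comp (measurable_powR r)).
exact: measurableT_comp mX.
Qed.

Let lt_F a w : 0 < a -> X w != 0 -> (F a < U w) = (a < `|X w|).
Proof.
move=> a0 w0; rewrite U_F// /F ltr_pM2r ?invr_gt0// ltr_expR ltr_pM2l// ltr_ln//.
by rewrite posrE normr_gt0.
Qed.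

Let le_F b w : 0 < b -> X w != 0 -> (U w <= F b) = (`|X w| <= b).
Proof. by move=> b0 w0; rewrite !leNgt lt_F. Qed.

Let F_surj (y : R) : 0 < y -> exists2 x : R, 0 < x & F x = y.
Proof.
move=> y0; exists (expR (ln (2 * y) / r)); first exact: expR_gt0.
rewrite /F expRK mulrCA divff ?gt_eqF// mulr1 lnK ?posrE ?mulr_gt0//.
by rewrite mulrC mulKf.
Qed.

Let F_gt0 x : 0 < F x. Proof. by rewrite divr_gt0// expR_gt0. Qed.

Let F_lt a b : 0 < a -> 0 < b -> (F a < F b) = (a < b).
Proof.
by move=> a0 b0; rewrite /F ltr_pM2r ?invr_gt0// ltr_expR ltr_pM2l// ltr_ln.
Qed.

Let continuous_f1 (x : R) : 0 < x -> {for x, continuous f1}.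
Proof.
move=> x0; have dNF := is_derive_oppf (dF x0).
have := is_derive_cmulf (is_derive_compf dNF (is_derive_expR (- F x))) (r / (2 `^ (1 + r^-1) * G)).
exact: is_derive_continuous.
Qed.

(** The two intervals form the preimage of ]F a, F b] under |x|^r/2; by symmetry each carries half
    of W(F b) - W(F a), W an antiderivative of the Gamma density. *)
Let integral_half_lines a b : 0 < a -> a < b ->
  (\int[mu]_(x in `]a, b]) (gnormal_pdf r x)%:E + \int[mu]_(x in `[(- b)%R, (- a)%R[) (gnormal_pdf r x)%:E =
   \int[mu]_(u in `[F a, F b]) (gamma_pdf r^-1 u)%:E)%E.
Proof.
move=> a0 ab; have b0 := lt_trans a0 ab; have [mf _ _] := Xr.
pose g u := gamma_weight r^-1 u / G.
have cg (u : R) : 0 < u -> {for u, continuous g}.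
  move=> u0; apply: (@continuousM R R); last exact: cst_continuous.
  exact: continuous_gamma_weight.
have [W DW] := antiderivative_exists (F b) (F_gt0 a) cg.
have FaFb : F a <= F b by rewrite ltW// F_lt.
have rng (x : R) : a <= x <= b -> F a <= F x <= F b.
  move=> /andP[ax xb]; have x0 := lt_le_trans a0 ax.
  by rewrite !leNgt !F_lt// -!leNgt ax.
have DWF (x : R) : a <= x <= b -> is_derive x 1 (fun y => 2^-1 * W (F y)) (f1 x).
  move=> xab; have x0 : 0 < x by case/andP: xab => + _; exact: lt_le_trans.
  have := is_derive_cmulf (is_derive_compf (dF x0) (DW _ (rng x xab))) 2^-1.
  by rewrite f1E// mulKf.
rewrite integral_itv_obnd_cbnd; last by apply/measurable_EFinP; exact: measurable_funTS.
rewrite integral_itv_bndo_bndc; last by apply/measurable_EFinP; exact: measurable_funTS.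
have -> : (\int[mu]_(x in `[a, b]) (gnormal_pdf r x)%:E = (2^-1 * W (F b) - 2^-1 * W (F a))%:E)%E.
  rewrite (_ : (\int[mu]_(x in `[a, b]) (gnormal_pdf r x)%:E = \int[mu]_(x in `[a, b]) (f1 x)%:E)%E).
    apply: (@integral_is_derive _ f1 (fun x => 2^-1 * W (F x))) => //; first exact: ltW.
    by move=> x /andP[ax _]; apply: continuous_f1; exact: lt_le_trans ax.
  apply: eq_integral => x; rewrite inE/= in_itv/= => /andP[ax _].
  have x0 := lt_le_trans a0 ax.
  by rewrite gnormal_pdfE ?gt_eqF// ger0_norm// ltW.
have -> : (\int[mu]_(x in `[(- b)%R, (- a)%R]) (gnormal_pdf r x)%:E =
    (- (2^-1 * W (F a)) - - (2^-1 * W (F b)))%:E)%E.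
  rewrite (_ : (\int[mu]_(x in `[(- b)%R, (- a)%R]) (gnormal_pdf r x)%:E =
     \int[mu]_(x in `[(- b)%R, (- a)%R]) (f1 (- x))%:E)%E).
    have rN (x : R) : - b <= x <= - a -> a <= - x <= b.
      by move=> /andP[bx xa]; rewrite lerNr xa lerNl.
    rewrite -{2}[a]opprK -{2}[b]opprK.
    apply: (@integral_is_derive _ (fun x => f1 (- x)) (fun x => - (2^-1 * W (F (- x))))) => //.
    - by rewrite lerN2 ltW.
    - move=> x /rN /andP[ax _]; apply: (@continuous_comp R R R (fun x => - x)).
        exact: (@continuousN R R R).
      by apply: continuous_f1; exact: lt_le_trans ax.
    - move=> x /rN xab.
      have DN : is_derive x 1 (fun x : R => - x) (-1 : R) by apply: is_derive_oppf; exact: is_derive_id.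
      have := is_derive_oppf (is_derive_compf DN (DWF _ xab)).
      by rewrite mulrN1 opprK.
  apply: eq_integral => x; rewrite inE/= in_itv/= => /andP[_ xa].
  have x0 : x < 0 by rewrite (le_lt_trans xa)// oppr_lt0.
  by rewrite gnormal_pdfE ?lt_eqF// ltr0_norm.
rewrite -EFinD; transitivity ((W (F b) - W (F a))%:E); first by congr EFin; field.
rewrite -(@integral_is_derive _ g W)//; last first.
  by move=> x /andP[ax _]; apply: cg; exact: lt_le_trans ax.
apply: eq_integral => x; rewrite inE/= in_itv/= => /andP[ax _].
by rewrite /gamma_pdf (lt_le_trans _ ax).
Qed.

Lemma has_density_gnormal_gamma : has_density P U (gamma_pdf r^-1).
Proof.
have [mf _ XP] := Xr.
apply: has_density_pos => //.
- exact: measurable_gamma_pdf.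
- by move=> x; rewrite gamma_pdf_ge0// invr_gt0.
- have -> : U @^-1` `]-oo, 0] = X @^-1` [set 0].
    apply/seteqP; split => w /=; rewrite in_itv/=.
      by apply: contraTP => /eqP w0; rewrite -ltNge U_gt0.
    by move=> /U_0 ->.
  by rewrite -[LHS]/(pushforward P X [set 0]) XP// integral_set1.
- by move=> x x0; rewrite /gamma_pdf ltNge x0.
move=> al be al0 albe; have be0 := lt_trans al0 albe.
have [a a0 aE] := F_surj al0; have [b b0 bE] := F_surj be0.
have ab : a < b by rewrite -F_lt// aE bE.
have -> : U @^-1` `]al, be] = X @^-1` (`]a, b] `|` `[- b, - a[).
  apply/seteqP; split => w /=; rewrite -aE -bE !in_itv/=.
    have [w0|w0] := eqVneq (X w) 0.
      by rewrite U_0// => /andP[]; rewrite ltNge ltW.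
    rewrite lt_F// le_F// => /andP[aX Xb].
    have [X0|X0] := ltP (X w) 0; [right|left].
      by move: aX Xb; rewrite ltr0_norm// lerNl ltrNr => -> ->.
    by move: aX Xb; rewrite ger0_norm// => -> ->.
  have w0 : (a < X w <= b) \/ (- b <= X w < - a) -> X w != 0.
    by case=> /andP[h1 h2]; [rewrite gt_eqF// (lt_trans a0)|rewrite lt_eqF// (lt_trans h2)// oppr_lt0].
  move=> h; rewrite lt_F ?le_F ?w0//; case: h => /andP[h1 h2].
    by rewrite ger0_norm ?h1// ltW// (lt_trans a0).
  by rewrite ltr0_norm ?(lt_trans h2) ?oppr_lt0// ltrNr h2 lerNl.
rewrite -[LHS]/(pushforward P X (`]a, b] `|` `[- b, - a[)) XP; last exact: measurableU.
rewrite ge0_integral_setU//; last 3 first.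
- by apply/measurable_EFinP; exact: measurable_funTS.
- by move=> x _; rewrite lee_fin; have [_ + _] := Xr; apply.
- apply/disj_setPS => x [] /=; rewrite !in_itv/= => /andP[ax _] /andP[_ xa].
  by have := lt_trans ax xa; rewrite ltrNr; lra.
rewrite integral_half_lines// aE bE integral_itv_obnd_cbnd//.
by apply/measurable_EFinP; apply: measurable_funTS; exact: measurable_gamma_pdf.
Qed.

End gnormal_law.

Lemma Rintegral_ae_eq d (T : measurableType d) (R : realType) (P : probability T R)
    (N : set T) (f g : T -> R) : measurable N -> P N = 0%E ->
  measurable_fun setT f -> measurable_fun setT g ->
  (forall w, ~ N w -> f w = g w) -> Rintegral P setT f = Rintegral P setT g.
Proof.
move=> mN N0 mf mg fg; rewrite /Rintegral; congr fine; apply: ae_eq_integral => //.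
- exact/measurable_EFinP.
- exact/measurable_EFinP.
- by exists N; split => // w /= H; apply: contrapT => /fg fgw; apply: H => _; rewrite fgw.
Qed.

(** * The characteristic function of log |X_r| *)

Section gnormal_transform.
Variable R : realType.
Local Notation mu := (@lebesgue_measure R).
Implicit Types r t : R.

(** The real part of psi_r(t) = 2^(it/r) Gamma((1+it)/r) / Gamma(1/r); [gnormal_im] is the imaginary
    part. *)
Definition gnormal_re r t : R :=
  (cos (t / r * ln 2) * gamma_re r^-1 (t / r) - sin (t / r * ln 2) * gamma_im r^-1 (t / r)) /
  gamma_real r^-1.

Definition gnormal_im r t : R :=
  (sin (t / r * ln 2) * gamma_re r^-1 (t / r) + cos (t / r * ln 2) * gamma_im r^-1 (t / r)) /
  gamma_real r^-1.

Lemma gnormal_transform_sqr r t : 0 < r ->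
  gnormal_re r t ^+ 2 + gnormal_im r t ^+ 2 = gamma_ratio r^-1 (t / r).
Proof.
move=> r0; have G0 : 0 < gamma_real r^-1 by rewrite gamma_real_gt0// invr_gt0.
rewrite /gnormal_re /gnormal_im !exprMn -mulrDl /gamma_ratio exprVn; congr (_ / _).
transitivity ((cos (t / r * ln 2) ^+ 2 + sin (t / r * ln 2) ^+ 2) * gamma_sqr r^-1 (t / r)).
  by rewrite /gamma_sqr; ring.
by rewrite cos2Dsin2 mul1r.
Qed.

Section law.
Context d (T : measurableType d) (P : probability T R).
Variables (X : T -> R) (r : R).
Hypotheses (r0 : 0 < r) (mX : measurable_fun setT X).
Hypothesis Xr : has_density P X (gnormal_pdf r).
Local Notation G := (gamma_real r^-1).

Lemma measurable_ln_norm : measurable_fun setT (fun w => ln `|X w|).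
Proof.
by apply: (measurableT_comp (@measurable_ln R)); exact: measurableT_comp mX.
Qed.

Lemma gnormal_null : P (X @^-1` [set 0]) = 0%E.
Proof.
have [_ _ XP] := Xr.
by rewrite -[LHS]/(pushforward P X [set 0]) XP// integral_set1.
Qed.

Let U w := `|X w| `^ r / 2.

Let mU : measurable_fun setT U.
Proof.
apply: measurable_funM => //; apply: (measurableT_comp (measurable_powR r)).
exact: measurableT_comp mX.
Qed.

Let lnU w : X w != 0 -> ln `|X w| = (ln (U w) + ln 2) / r.
Proof.
move=> w0; have Xw : 0 < `|X w| by rewrite normr_gt0.
rewrite /U ln_div ?posrE ?powR_gt0// subrK ln_powR mulrC mulKf ?gt_eqF//.
Qed.

(** Off the null event X = 0 one has ln |X| = (ln U + ln 2)/r, and [U] has the Gamma law; the shift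
    ln 2 is the source of the factor 2^(it/r). *)
Lemma gnormal_expectation (h : R -> R) : measurable_fun setT h -> (forall x, `|h x| <= 1) ->
  Rintegral P setT (fun w => h (ln `|X w|)) =
  Rintegral mu (`]0, +oo[%classic : set R) (fun u => gamma_weight r^-1 u * h ((ln u + ln 2) / r)) / G.
Proof.
move=> mh h1.
have mk : measurable_fun setT (fun u : R => (ln u + ln 2) / r).
  apply: measurable_funM => //; apply: measurable_funD => //.
have mhk : measurable_fun setT (fun u : R => h ((ln u + ln 2) / r)).
  exact: measurableT_comp mh mk.
have mN : measurable (X @^-1` [set 0]).
  by rewrite -[X in measurable X]setTI; exact: mX.
rewrite (@Rintegral_ae_eq _ _ _ P (X @^-1` [set 0]) _ (fun w => h ((ln (U w) + ln 2) / r))) => //; last 4 first.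
- exact: gnormal_null.
- exact: measurableT_comp mh measurable_ln_norm.
- exact: (measurableT_comp mhk mU).
- by move=> w /eqP/= w0; rewrite lnU.
rewrite (Rintegral_has_density mU (has_density_gnormal_gamma r0 mX Xr) mhk)//.
rewrite gamma_pdfE.
have r1 : 0 < r^-1 by rewrite invr_gt0.
have i1 : mu.-integrable `]0, +oo[ (EFin \o (fun u => gamma_weight r^-1 u * h ((ln u + ln 2) / r))).
  apply: (@integrable_gammaM _ _ _ 1) => //; exact: measurable_funTS.
rewrite mulrC -RintegralZl// [in RHS]Rintegral_mkcond; apply: eq_Rintegral => u _.
rewrite !patchE; case: ifP => _; last by rewrite mulr0.
by ring.
Qed.

Lemma gnormal_char_cos t : char_cos P (fun w => ln `|X w|) t = gnormal_re r t.
Proof.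
rewrite /char_cos (gnormal_expectation (h := fun x => cos (t * x))); last 2 first.
- by apply: measurable_cosf; exact: measurable_funM.
- by move=> x; exact: cos_max.
rewrite /gnormal_re; congr (_ / _).
rewrite -mulNr -Rintegral_gamma_combo ?invr_gt0//; apply: eq_Rintegral => u _.
have -> : t * ((ln u + ln 2) / r) = t / r * ln 2 + t / r * ln u by ring.
by rewrite cosD; ring.
Qed.

Lemma gnormal_char_sin t : char_sin P (fun w => ln `|X w|) t = gnormal_im r t.
Proof.
rewrite /char_sin (gnormal_expectation (h := fun x => sin (t * x))); last 2 first.
- by apply: measurable_sinf; exact: measurable_funM.
- by move=> x; exact: sin_max.
rewrite /gnormal_im; congr (_ / _).
rewrite -Rintegral_gamma_combo ?invr_gt0//; apply: eq_Rintegral => u _.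
have -> : t * ((ln u + ln 2) / r) = t / r * ln 2 + t / r * ln u by ring.
by rewrite sinD; ring.
Qed.

End law.

End gnormal_transform.

(** * Expectations under equality in law and under independence *)

Section expectations.
Variable R : realType.
Local Notation RT := (measurableTypeR R).

Lemma eq_in_law_expectation d (T : measurableType d) d' (T' : measurableType d')
    (P : probability T R) (X : T -> R) (P' : probability T' R) (X' : T' -> R) (h : R -> R) :
  measurable_fun setT X -> measurable_fun setT X' -> eq_in_law P X P' X' ->
  measurable_fun setT h -> (forall x, `|h x| <= 1) ->
  Rintegral P setT (fun w => h (X w)) = Rintegral P' setT (fun w => h (X' w)).
Proof.
move=> mX mX' XX' mh h1.
have mX1 : measurable_fun [set: T] (X : T -> RT) by [].
have mX1' : measurable_fun [set: T'] (X' : T' -> RT) by [].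
have mhE : measurable_fun [set: RT] (EFin \o h) by apply/measurable_EFinP.
rewrite /Rintegral; congr fine.
transitivity (\int[pushforward P (X : T -> RT)]_x (h x)%:E)%E.
  rewrite (integral_pushforward mX1 mhE)//= preimage_setT.
  apply: (@integrable_bounded_RV _ _ _ P _ 1); last by move=> w; exact: h1.
  exact: measurableT_comp mh mX.
transitivity (\int[pushforward P' (X' : T' -> RT)]_x (h x)%:E)%E; last first.
  rewrite (integral_pushforward mX1' mhE)//= preimage_setT.
  apply: (@integrable_bounded_RV _ _ _ P' _ 1); last by move=> w; exact: h1.
  exact: measurableT_comp mh mX'.
by apply: eq_measure_integral => A mA _; exact: XX'.
Qed.

(** Independence on rectangles identifies the joint law with the product of the marginal laws;
    boundedness then permits iterated integration. *)
Lemma independent_expectation d (T : measurableType d) (P : probability T R)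
    (V X : {RV P >-> R}) (f h : R -> R) : independent_RV P V X ->
  measurable_fun setT f -> measurable_fun setT h ->
  (forall x, `|f x| <= 1) -> (forall x, `|h x| <= 1) ->
  Rintegral P setT (fun w => f (V w) * h (X w)) =
  Rintegral P setT (fun w => f (V w)) * Rintegral P setT (fun w => h (X w)).
Proof.
move=> VX mf mh f1 h1.
pose m1 := distribution P V; pose m2 := distribution P X.
pose Z w := (V w, X w).
have mZ : measurable_fun setT Z by exact: measurable_fun_pair.
have m12 C : measurable C -> (m1 \x m2)%E C = pushforward P Z C.
  by apply: product_measure_unique => A B mA mB; exact: VX.
pose F (z : R * R) := (f z.1 * h z.2)%:E.
have F1 z : `|f z.1 * h z.2| <= 1 by rewrite normrM mulr_ile1.
have mF' : measurable_fun setT (fun z : R * R => f z.1 * h z.2).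
  apply: measurable_funM.
  - exact: (measurableT_comp mf measurable_fst).
  - exact: (measurableT_comp mh measurable_snd).
have mF : measurable_fun setT F by exact/measurable_EFinP.
have iF : P.-integrable setT (F \o Z).
  apply: (@integrable_bounded_RV _ _ _ P (fun w => f (V w) * h (X w)) 1).
    exact: measurableT_comp mF' mZ.
  by move=> w; exact: (F1 (V w, X w)).
have ih : m2.-integrable setT (EFin \o h).
  exact: (@integrable_bounded_RV _ _ _ m2 h 1).
have if' : m1.-integrable setT (EFin \o f).
  exact: (@integrable_bounded_RV _ _ _ m1 f 1).
have iF12 : (m1 \x m2)%E.-integrable setT F.
  apply/integrable12ltyP => //.
  apply: (@le_lt_trans _ _ (\int[m1]_x (\int[m2]_y 1))%E).
    apply: ge0_le_integral => //.
    - by move=> x _; exact: integral_ge0.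
    - apply: (measurable_fun_fubini_tonelli_F (fun z => `|F z|)%E) => //.
      exact: measurableT_comp.
    - move=> x _; apply: ge0_le_integral => //.
      + apply: measurableT_comp => //; apply/measurable_EFinP.
        exact: (measurableT_comp mF' (measurable_pair1 x)).
      + by move=> y _; rewrite lee_fin; exact: (F1 (x, y)).
  have m1T : m1 setT = 1%E := probability_setT m1.
  have m2T : m2 setT = 1%E := probability_setT m2.
  have m2c : (\int[m2]__ 1 = 1)%E by rewrite (integral_cst m2 measurableT 1) mul1e.
  have m1c : (\int[m1]__ 1 = 1)%E by rewrite (integral_cst m1 measurableT 1) mul1e.
  by rewrite m2c m1c ltry.
have E1 (g : R -> R) (Y : {RV P >-> R}) : measurable_fun setT g -> (forall x, `|g x| <= 1) ->
    Rintegral P setT (fun w => g (Y w)) = Rintegral (distribution P Y) setT g.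
  move=> mg g1; rewrite /Rintegral; congr fine; rewrite integral_distribution//.
    exact/measurable_EFinP.
  apply: (@integrable_bounded_RV _ _ _ P (fun w => g (Y w)) 1) => //.
  exact: measurableT_comp.
rewrite (E1 f V)// (E1 h X)// -RintegralZr// /Rintegral; congr fine.
transitivity (\int[pushforward P Z]_z F z)%E.
  by rewrite (integral_pushforward mZ mF)//= preimage_setT.
transitivity (\int[m1 \x m2]_z F z)%E.
  by apply: eq_measure_integral => A mA _; apply: esym; exact: m12.
rewrite -(integral12_prod_meas1 iF12); apply: eq_integral => x _.
rewrite /fubini_F /F/=; under eq_integral do rewrite EFinM.
rewrite integralZl// EFinM; congr (_ * _)%E.
by rewrite fineK// integrable_fin_num.
Qed.

End expectations.

(** * Continuity, measurability and parity in t *)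

Section gamma_continuity.
Variable R : realType.
Local Notation mu := (@lebesgue_measure R).
Local Notation RT := (measurableTypeR R).
Implicit Types a r t : R.

Lemma continuous_gamma_integral a (f : R -> R) : 0 < a -> continuous f -> (forall x, `|f x| <= 1) ->
  continuous (fun t : R => Rintegral mu (`]0, +oo[%classic : set R) (fun x => gamma_weight a x * f (t * ln x))).
Proof.
move=> a0 cf f1 t.
have mf : measurable_fun setT f by exact: continuous_measurable_fun.
have : {in `]t - 1, t + 1[%classic, continuous (fun l : R => Rintegral mu (`]0, +oo[%classic : set R)
    (fun x => gamma_weight a x * f (l * ln x)))}.
  apply: (@continuity_under_integral R _ RT mu (fun l x : R => gamma_weight a x * f (l * ln x))
    `]0, +oo[%classic (measurable_itv _) _ _ _ _ (gamma_weight a)) => //.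
  - move=> l _; apply: (@integrable_gammaM _ _ _ 1) => //.
    by apply: measurable_funTS; apply: (measurableT_comp mf); exact: measurable_funM.
  - apply: aeW => x _ l _.
    apply: (@continuousM R R (fun=> gamma_weight a x)); first exact: cst_continuous.
    apply: (@continuous_comp R R R (fun l : R => l * ln x)); last exact: cf.
    apply: (@continuousM R R id (fun=> ln x)) => //; exact: cst_continuous.
  - exact: integrable_gamma_weight.
  - move=> l _; apply: aeW => x _.
    by rewrite normrM gtr0_norm ?gamma_weight_gt0// ler_piMr// ltW// gamma_weight_gt0.
apply; rewrite inE/= in_itv/=; apply/andP; split; lra.
Qed.

Lemma continuous_gamma_re a : 0 < a -> continuous (gamma_re a).
Proof.
by move=> a0; apply: (@continuous_gamma_integral a cos) => // [x|x];
  [exact: continuous_cos|exact: cos_max].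
Qed.

Lemma continuous_gamma_im a : 0 < a -> continuous (gamma_im a).
Proof.
by move=> a0; apply: (@continuous_gamma_integral a sin) => // [x|x];
  [exact: continuous_sin|exact: sin_max].
Qed.

(** Conjugate symmetry in t, here and in the next lemmas, passes to Phi and makes the inversion
    integral real. *)
Lemma gamma_reN a t : gamma_re a (- t) = gamma_re a t.
Proof. by apply: eq_Rintegral => x _; rewrite mulNr cosN. Qed.

Lemma gamma_imN a t : 0 < a -> gamma_im a (- t) = - gamma_im a t.
Proof.
move=> a0; rewrite -[RHS]mulN1r /gamma_im -RintegralZl//; last exact: integrable_gamma_sin.
by apply: eq_Rintegral => x _; rewrite mulNr sinN mulN1r mulrN.
Qed.

Lemma gnormal_reN r t : 0 < r -> gnormal_re r (- t) = gnormal_re r t.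
Proof.
move=> r0; rewrite /gnormal_re !mulNr cosN sinN gamma_reN gamma_imN ?invr_gt0//.
by rewrite mulrNN.
Qed.

Lemma gnormal_imN r t : 0 < r -> gnormal_im r (- t) = - gnormal_im r t.
Proof.
move=> r0; rewrite /gnormal_im !mulNr cosN sinN gamma_reN gamma_imN ?invr_gt0//.
by rewrite mulrN -!mulNr; congr (_ / _); rewrite !mulNr opprD.
Qed.

Lemma measurable_gnormal_re r : 0 < r -> measurable_fun setT (gnormal_re r).
Proof.
move=> r0; have r1 : 0 < r^-1 by rewrite invr_gt0.
have m1 : measurable_fun setT (fun t : R => t / r) by exact: measurable_funM.
apply: measurable_funM => //; apply: measurable_funB; apply: measurable_funM.
- by apply: measurable_cosf; exact: measurable_funM.
- exact: (measurableT_comp (continuous_measurable_fun (continuous_gamma_re r1)) m1).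
- by apply: measurable_sinf; exact: measurable_funM.
- exact: (measurableT_comp (continuous_measurable_fun (continuous_gamma_im r1)) m1).
Qed.

Lemma measurable_gnormal_im r : 0 < r -> measurable_fun setT (gnormal_im r).
Proof.
move=> r0; have r1 : 0 < r^-1 by rewrite invr_gt0.
have m1 : measurable_fun setT (fun t : R => t / r) by exact: measurable_funM.
apply: measurable_funM => //; apply: measurable_funD; apply: measurable_funM.
- by apply: measurable_sinf; exact: measurable_funM.
- exact: (measurableT_comp (continuous_measurable_fun (continuous_gamma_re r1)) m1).
- by apply: measurable_cosf; exact: measurable_funM.
- exact: (measurableT_comp (continuous_measurable_fun (continuous_gamma_im r1)) m1).
Qed.

(** Lebesgue measure is its own image under reflection, so the integral equals its opposite. *)
Lemma Rintegral_odd (f : R -> R) : mu.-integrable setT (EFin \o f) ->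
  (forall t, f (- t) = - f t) -> Rintegral mu setT f = 0.
Proof.
move=> intf oddf; have mf : measurable_fun [set: RT] (EFin \o f) by exact: measurable_int intf.
have mN : measurable_fun [set: RT] (-%R : RT -> RT) by exact: measurable_funN.
suff : Rintegral mu setT f = - Rintegral mu setT f by lra.
rewrite -mulN1r -RintegralZl// [LHS]/Rintegral.
rewrite -[LHS]/(fine (\int[mu]_x (f x)%:E)%E) /Rintegral; congr fine.
transitivity (\int[pushforward mu (-%R : RT -> RT)]_x (f x)%:E)%E.
  by apply: eq_measure_integral => A mA _; apply: esym; exact: lebesgue_measureN.
have iN : mu.-integrable setT ((EFin \o f) \o (-%R : RT -> RT)).
  have -> : ((EFin \o f) \o (-%R : RT -> RT)) = (EFin \o (fun x => - 1 * f x)).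
    by apply/funext => x /=; rewrite oddf mulN1r.
  exact: integrableZr_EFin.
have -> : (\int[pushforward mu (-%R : RT -> RT)]_x (f x)%:E = \int[mu]_x (f (- x))%:E)%E.
  exact: (@integral_pushforward _ _ _ _ _ _ mN mu setT _ mf iN measurableT).
by apply: eq_integral => x _ /=; rewrite oddf mulN1r.
Qed.

End gamma_continuity.

Lemma measurable_fun_posV d (T : measurableType d) (R : realType) (f : T -> R) :
  (forall x, 0 < f x) -> measurable_fun setT f -> measurable_fun setT (fun x => (f x)^-1).
Proof.
move=> f0 mf; have -> : (fun x => (f x)^-1) = (fun x => expR (- ln (f x))).
  by apply/funext => x; rewrite expRN lnK// posrE.
apply: (measurableT_comp (@measurable_expR R)); apply: measurable_funN.
exact: (measurableT_comp (@measurable_ln R)).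
Qed.

(** * The function Phi and the law of V *)

Section Phi_transform.
Variables (R : realType) (p q : R).
Hypotheses (p0 : 0 < p) (pq : p < q).
Local Notation mu := (@lebesgue_measure R).
Implicit Types (r t y : R).

Let q0 : 0 < q. Proof. exact: lt_trans p0 pq. Qed.

Lemma gnormal_sqr_gt0 r t : 0 < r -> 0 < gnormal_re r t ^+ 2 + gnormal_im r t ^+ 2.
Proof. by move=> r0; rewrite gnormal_transform_sqr// gamma_ratio_gt0. Qed.

(** The real part of psi_p(t)/psi_q(t), written as psi_p times the conjugate of psi_q over
    |psi_q|^2. *)
Definition Phi_re t : R :=
  (gnormal_re p t * gnormal_re q t + gnormal_im p t * gnormal_im q t) /
  (gnormal_re q t ^+ 2 + gnormal_im q t ^+ 2).

Definition Phi_im t : R :=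
  (gnormal_im p t * gnormal_re q t - gnormal_re p t * gnormal_im q t) /
  (gnormal_re q t ^+ 2 + gnormal_im q t ^+ 2).

Lemma pow2i_GammaC r t : 0 < r ->
  (pow2i r t * GammaC ((1 +i* t) / r%:C) = (gamma_real r^-1)%:C * (gnormal_re r t +i* gnormal_im r t))%C.
Proof.
move=> r0; have G0 : gamma_real r^-1 != 0 by rewrite gt_eqF// gamma_real_gt0// invr_gt0.
rewrite pow2iE GammaC_line /gnormal_re /gnormal_im; simpc.
by congr (_ +i* _)%C; rewrite [RHS]mulrC divfK// addrC.
Qed.

Lemma complex_neq0 (a b : R) : 0 < a ^+ 2 + b ^+ 2 -> (a +i* b)%C != 0.
Proof.
by apply: contraTneq => -[-> ->]; rewrite expr0n/= addr0 ltxx.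
Qed.

Lemma PhiE t : Phi p q t = (Phi_re t +i* Phi_im t)%C.
Proof.
have Gp : ((gamma_real p^-1)%:C != 0)%C.
  by rewrite fmorph_eq0 gt_eqF// gamma_real_gt0// invr_gt0.
have Gq : ((gamma_real q^-1)%:C != 0)%C.
  by rewrite fmorph_eq0 gt_eqF// gamma_real_gt0// invr_gt0.
have Zq2 := gnormal_sqr_gt0 t q0; have Zq := complex_neq0 Zq2.
rewrite /Phi !pow2i_GammaC// !GammaC_real.
(* Stated as a product, psi_p = Phi psi_q, the identity leaves only nonzero factors to cancel in the
   definition of [Phi]. *)
have ZpE : (gnormal_re p t +i* gnormal_im p t =
    (Phi_re t +i* Phi_im t) * (gnormal_re q t +i* gnormal_im q t))%C.
  rewrite /Phi_re /Phi_im; move: (gnormal_re q t) (gnormal_im q t) Zq2 => c s cs.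
  simpc; congr (_ +i* _)%C; field; exact: lt0r_neq0.
rewrite ZpE; apply: (mulIf (mulf_neq0 (mulf_neq0 Gq Zq) Gp)); rewrite mulfVK ?mulf_neq0//.
move: (Phi_re t +i* Phi_im t)%C (gnormal_re q t +i* gnormal_im q t)%C (gamma_real p^-1)%:C%C.
by move: (gamma_real q^-1)%:C%C => a b c e; ring.
Qed.

Lemma Phi_sqr t : Phi_re t ^+ 2 + Phi_im t ^+ 2 = gamma_ratio p^-1 (t / p) / gamma_ratio q^-1 (t / q).
Proof.
have := gnormal_sqr_gt0 t q0.
rewrite -(gnormal_transform_sqr t p0) -(gnormal_transform_sqr t q0) /Phi_re /Phi_im.
move: (gnormal_re p t) (gnormal_im p t) (gnormal_re q t) (gnormal_im q t) => a b c s cs.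
by field; exact: lt0r_neq0.
Qed.

Definition Phi_abs t : R := Num.sqrt (Phi_re t ^+ 2 + Phi_im t ^+ 2).

Lemma Phi_abs_ge0 t : 0 <= Phi_abs t.
Proof. exact: sqrtr_ge0. Qed.

Lemma normc_Phi t : ComplexField.Normc.normc (Phi p q t) = Phi_abs t.
Proof. by rewrite PhiE. Qed.

(** The decay was proved for squared moduli; taking the root halves the rate. *)
Lemma Phi_abs_le : exists2 e : R, 0 < e & exists K : R, forall t,
  Phi_abs t <= K * expR (- e * `|t|).
Proof.
have [l l0 [K K0 H]] := gamma_ratio_le_expR p0 pq.
exists (l / 2); first exact: divr_gt0.
exists (Num.sqrt K) => t; rewrite /Phi_abs Phi_sqr.
have -> : Num.sqrt K * expR (- (l / 2) * `|t|) = Num.sqrt (K * expR (- l * `|t|)).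
  rewrite sqrtrM ?ltW//; congr (_ * _).
  rewrite -[in RHS](_ : expR (- (l / 2) * `|t|) ^+ 2 = expR (- l * `|t|)).
    by rewrite sqrtr_sqr [RHS]ger0_norm ?expR_ge0.
  by rewrite -expRM_natl; congr expR; field.
by rewrite ler_wsqrtr// ler_pdivrMr ?gamma_ratio_gt0.
Qed.

Lemma measurable_Phi_re : measurable_fun setT Phi_re.
Proof.
rewrite /Phi_re; apply: measurable_funM.
  by apply: measurable_funD; apply: measurable_funM;
    (exact: measurable_gnormal_re || exact: measurable_gnormal_im).
apply: measurable_fun_posV => [t|]; first exact: gnormal_sqr_gt0.
by apply: measurable_funD; apply: measurable_funX;
    (exact: measurable_gnormal_re || exact: measurable_gnormal_im).
Qed.

Lemma measurable_Phi_im : measurable_fun setT Phi_im.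
Proof.
rewrite /Phi_im; apply: measurable_funM.
  by apply: measurable_funB; apply: measurable_funM;
    (exact: measurable_gnormal_re || exact: measurable_gnormal_im).
apply: measurable_fun_posV => [t|]; first exact: gnormal_sqr_gt0.
by apply: measurable_funD; apply: measurable_funX;
    (exact: measurable_gnormal_re || exact: measurable_gnormal_im).
Qed.

Lemma integrable_Phi_abs : mu.-integrable setT (EFin \o Phi_abs).
Proof.
have [e e0 [K PhiK]] := Phi_abs_le.
apply: (@le_integrable _ _ _ mu setT measurableT _ (EFin \o (fun t => K * expR (- e * `|t|)))).
- apply/measurable_EFinP.
  apply: (measurableT_comp (continuous_measurable_fun (@sqrt_continuous R))).
  by apply: measurable_funD; apply: measurable_funX;
    (exact: measurable_Phi_re || exact: measurable_Phi_im).
- move=> t _; rewrite /= lee_fin ger0_norm ?Phi_abs_ge0//.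
  by rewrite (le_trans (PhiK t))// ler_norm.
- by apply: integrableZr_EFin => //; exact: integrable_expR_norm.
Qed.

Lemma L1C_Phi : L1C (Phi p q).
Proof.
split.
- by under eq_fun do rewrite PhiE; exact: measurable_Phi_re.
- by under eq_fun do rewrite PhiE; exact: measurable_Phi_im.
- under eq_integral do rewrite normc_Phi.
  have -> : (\int[mu]_x (Phi_abs x)%:E = \int[mu]_x `|(EFin \o Phi_abs) x|)%E.
    by apply: eq_integral => t _; rewrite /= ger0_norm ?Phi_abs_ge0.
  by have /integrableP[] := integrable_Phi_abs.
Qed.

Lemma integrable_Phi_re : mu.-integrable setT (EFin \o Phi_re).
Proof.
apply: le_integrable integrable_Phi_abs => //.
  by apply/measurable_EFinP; exact: measurable_Phi_re.
move=> t _; rewrite /= lee_fin [leRHS]ger0_norm ?Phi_abs_ge0//.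
by rewrite -sqrtr_sqr ler_wsqrtr// lerDl sqr_ge0.
Qed.

Lemma integrable_Phi_im : mu.-integrable setT (EFin \o Phi_im).
Proof.
apply: le_integrable integrable_Phi_abs => //.
  by apply/measurable_EFinP; exact: measurable_Phi_im.
move=> t _; rewrite /= lee_fin [leRHS]ger0_norm ?Phi_abs_ge0//.
by rewrite -sqrtr_sqr ler_wsqrtr// lerDr sqr_ge0.
Qed.

Lemma Phi_reN t : Phi_re (- t) = Phi_re t.
Proof. by rewrite /Phi_re !gnormal_reN// !gnormal_imN// mulrNN sqrrN. Qed.

Lemma Phi_imN t : Phi_im (- t) = - Phi_im t.
Proof.
rewrite /Phi_im !gnormal_reN// !gnormal_imN// sqrrN -[RHS]mulNr; congr (_ / _).
by rewrite mulNr mulrN opprK opprB addrC.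
Qed.

Lemma gpq_integrand y t : (expC (0 +i* (- (t * y))) * Phi p q t =
  fourier_integrand Phi_re Phi_im y t +i* (cos (t * y) * Phi_im t - sin (t * y) * Phi_re t))%C.
Proof.
rewrite expC_Complex expR0 !mul1r cosN sinN PhiE /fourier_integrand; simpc.
by congr (_ +i* _)%C; rewrite ?mulNr ?opprK// addrC.
Qed.

Lemma gpqE y : gpq p q y = (inverse_fourier Phi_re Phi_im y +i*
  ((2 * pi)^-1 * Rintegral mu setT (fun t => cos (t * y) * Phi_im t - sin (t * y) * Phi_re t)))%C.
Proof.
rewrite /gpq; under [X in integralC _ X]eq_fun do rewrite gpq_integrand.
by rewrite /integralC /inverse_fourier; simpc.
Qed.

Lemma gpq_re y : complex.Re (gpq p q y) = inverse_fourier Phi_re Phi_im y.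
Proof. by rewrite gpqE. Qed.

Lemma gpq_im y : complex.Im (gpq p q y) = 0.
Proof.
rewrite gpqE; set I := Rintegral _ _ _; suff I0 : I = 0 by rewrite I0 mulr0.
apply: Rintegral_odd; last first.
  by move=> t; rewrite mulNr cosN sinN Phi_reN Phi_imN; ring.
(* The imaginary part for Phi is the real part for -i Phi, whose components are Phi_im and
   -Phi_re. *)
have := @integrable_fourier_integrand R Phi_im (fun t => - Phi_re t) integrable_Phi_im.
have iN : mu.-integrable setT (EFin \o (fun t => - Phi_re t)).
  have -> : (fun t => - Phi_re t) = (fun t => -1 * Phi_re t) by apply/funext => t; rewrite mulN1r.
  exact: integrableZr_EFin integrable_Phi_re.
move=> /(_ iN y); congr (mu.-integrable setT _).
by apply/funext => t /=; rewrite /fourier_integrand mulrN.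
Qed.

Lemma continuous_gpq_re : continuous (fun y : R => complex.Re (gpq p q y)).
Proof.
under eq_fun do rewrite gpq_re.
exact: continuous_inverse_fourier integrable_Phi_re integrable_Phi_im.
Qed.

End Phi_transform.

(** * Identification of the law of V *)

Section ratio_law.
Context (R : realType) (p q : R) (p0 : 0 < p) (pq : p < q).
Context d (T : measurableType d) (P : probability T R) (V Xq : {RV P >-> R}).
Context d' (T' : measurableType d') (P' : probability T' R) (Xp : {RV P' >-> R}).
Hypotheses (V0 : {ae P, forall w, 0 < V w})
  (Xq_density : has_density P Xq (gnormal_pdf q))
  (Xp_density : has_density P' Xp (gnormal_pdf p))
  (VXq : independent_RV P V Xq)
  (Xp_law : eq_in_law P' Xp P (fun w => V w * Xq w)).
Local Notation mu := (@lebesgue_measure R).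

Let q0 : 0 < q. Proof. exact: lt_trans p0 pq. Qed.

Lemma measurable_npos : measurable (V @^-1` `]-oo, 0]).
Proof. exact: measurable_funPTI. Qed.

Lemma probability_npos : P (V @^-1` `]-oo, 0]) = 0%E.
Proof.
have [N [mN N0 VN]] := V0; apply: (subset_measure0 measurable_npos mN _ N0) => w /=.
by rewrite in_itv/= => w0; apply: VN => /=; apply/negP; rewrite -leNgt.
Qed.

(** The logarithm of |V X_q| splits into a sum off the null event V <= 0 or X_q = 0. *)
Lemma ratio_expectation (f : R -> R) t : measurable_fun setT f -> (forall x, `|f x| <= 1) ->
  Rintegral P' setT (fun w => f (t * ln `|Xp w|)) =
  Rintegral P setT (fun w => f (t * ln (V w) + t * ln `|Xq w|)).
Proof.
move=> mf f1; pose h (x : R) := f (t * ln `|x|).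
have mlnn : measurable_fun setT (fun x : R => ln `|x|).
  exact: (measurableT_comp (@measurable_ln R)).
have mh : measurable_fun setT h.
  by apply: (measurableT_comp mf); exact: measurable_funM.
have mVX : measurable_fun setT (fun w => V w * Xq w) by exact: measurable_funM.
have mXp : measurable_fun setT Xp by [].
rewrite (eq_in_law_expectation (h := h) mXp mVX Xp_law mh); last by move=> x; exact: f1.
have m0 : measurable (Xq @^-1` [set 0]) by exact: measurable_funPTI.
apply: (@Rintegral_ae_eq _ _ _ P (V @^-1` `]-oo, 0] `|` Xq @^-1` [set 0])).
- exact: measurableU measurable_npos m0.
- by rewrite (measureU0 measurable_npos m0 (gnormal_null Xq_density)); exact: probability_npos.
- exact: measurableT_comp mh mVX.
- apply: (measurableT_comp mf); apply: measurable_funD; apply: measurable_funM => //.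
  + exact: (measurableT_comp (@measurable_ln R)).
  + exact: (measurableT_comp mlnn).
- move=> w /not_orP[/= +/eqP Xw]; rewrite in_itv/= => /negP; rewrite -ltNge => Vw.
  rewrite /h normrM (gtr0_norm Vw) lnM ?posrE ?normr_gt0//.
  by rewrite mulrDr.
Qed.

Let cV t := char_cos P (fun w => ln (V w)) t.
Let sV t := char_sin P (fun w => ln (V w)) t.

Lemma integrable_trigM (f g : R -> R) t : measurable_fun setT f -> (forall x, `|f x| <= 1) ->
  measurable_fun setT g -> (forall x, `|g x| <= 1) ->
  P.-integrable setT (EFin \o (fun w => f (t * ln (V w)) * g (t * ln `|Xq w|))).
Proof.
move=> mf f1 mg g1; apply: (@integrable_bounded_RV _ _ _ P _ 1); last first.
  by move=> w; rewrite normrM mulr_ile1.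
apply: measurable_funM.
- apply: (measurableT_comp mf); apply: measurable_funM => //.
  exact: (measurableT_comp (@measurable_ln R)).
- apply: (measurableT_comp mg); apply: measurable_funM => //.
  exact: measurable_ln_norm.
Qed.

Lemma trig_expectationM (f g : R -> R) t : measurable_fun setT f -> (forall x, `|f x| <= 1) ->
  measurable_fun setT g -> (forall x, `|g x| <= 1) ->
  Rintegral P setT (fun w => f (t * ln (V w)) * g (t * ln `|Xq w|)) =
  Rintegral P setT (fun w => f (t * ln (V w))) * Rintegral P setT (fun w => g (t * ln `|Xq w|)).
Proof.
move=> mf f1 mg g1.
apply: (independent_expectation (f := fun v => f (t * ln v)) (h := fun x : R => g (t * ln `|x|))) => //.
- by apply: (measurableT_comp mf); exact: measurable_funM.
- apply: (measurableT_comp mg); apply: measurable_funM => //.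
  exact: (measurableT_comp (@measurable_ln R)).
Qed.

Let mcos : measurable_fun setT (@cos R).
Proof. by apply: continuous_measurable_fun; exact: continuous_cos. Qed.

Let msin : measurable_fun setT (@sin R).
Proof. by apply: continuous_measurable_fun; exact: continuous_sin. Qed.

Let mXp : measurable_fun setT Xp. Proof. by []. Qed.
Let mXq : measurable_fun setT Xq. Proof. by []. Qed.

(** With [ratio_sin], the components of psi_p = psi_V psi_q: the addition formulas, with each
    product factored by independence. *)
Lemma ratio_cos t : gnormal_re p t = cV t * gnormal_re q t - sV t * gnormal_im q t.
Proof.
rewrite -(gnormal_char_cos p0 mXp Xp_density) -(gnormal_char_cos q0 mXq Xq_density).
rewrite -(gnormal_char_sin q0 mXq Xq_density) /cV /sV /char_cos /char_sin.
rewrite (ratio_expectation _ mcos (@cos_max R)).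
rewrite -(trig_expectationM _ mcos (@cos_max R) mcos (@cos_max R)).
rewrite -(trig_expectationM _ msin (@sin_max R) msin (@sin_max R)).
rewrite -RintegralB//; last 2 first.
- exact: integrable_trigM mcos (@cos_max R) mcos (@cos_max R).
- exact: integrable_trigM msin (@sin_max R) msin (@sin_max R).
by apply: eq_Rintegral => w _; rewrite cosD.
Qed.

Lemma ratio_sin t : gnormal_im p t = sV t * gnormal_re q t + cV t * gnormal_im q t.
Proof.
rewrite -(gnormal_char_sin p0 mXp Xp_density) -(gnormal_char_cos q0 mXq Xq_density).
rewrite -(gnormal_char_sin q0 mXq Xq_density) /cV /sV /char_cos /char_sin.
rewrite (ratio_expectation _ msin (@sin_max R)).
rewrite -(trig_expectationM _ msin (@sin_max R) mcos (@cos_max R)).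
rewrite -(trig_expectationM _ mcos (@cos_max R) msin (@sin_max R)).
rewrite -RintegralD//; last 2 first.
- exact: integrable_trigM msin (@sin_max R) mcos (@cos_max R).
- exact: integrable_trigM mcos (@cos_max R) msin (@sin_max R).
by apply: eq_Rintegral => w _; rewrite sinD.
Qed.

(** The two component equations are linear in [cV t] and [sV t], with determinant |psi_q(t)|^2 >
    0. *)
Lemma char_cos_ratio t : cV t = Phi_re p q t.
Proof.
rewrite /Phi_re ratio_cos ratio_sin; have := gnormal_sqr_gt0 t q0.
move: (cV t) (sV t) (gnormal_re q t) (gnormal_im q t) => a b c s cs.
by field; exact: lt0r_neq0.
Qed.

Lemma char_sin_ratio t : sV t = Phi_im p q t.
Proof.
rewrite /Phi_im ratio_cos ratio_sin; have := gnormal_sqr_gt0 t q0.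
move: (cV t) (sV t) (gnormal_re q t) (gnormal_im q t) => a b c s cs.
by field; exact: lt0r_neq0.
Qed.

Lemma has_density_ln_ratio :
  has_density P (fun w => ln (V w)) (fun y => complex.Re (gpq p q y)).
Proof.
have cE : char_cos P (fun w => ln (V w)) = Phi_re p q by apply/funext => t; exact: char_cos_ratio.
have sE : char_sin P (fun w => ln (V w)) = Phi_im p q by apply/funext => t; exact: char_sin_ratio.
have -> : (fun y => complex.Re (gpq p q y)) =
    inverse_fourier (char_cos P (fun w => ln (V w))) (char_sin P (fun w => ln (V w))).
  by apply/funext => y; rewrite (gpq_re p0 pq) cE sE.
apply: has_density_inversion.
- by apply: (measurableT_comp (@measurable_ln R)).
- by rewrite cE; exact: integrable_Phi_re.
- by rewrite sE; exact: integrable_Phi_im.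
Qed.

Lemma gpq_ge0 y : 0 <= complex.Re (gpq p q y).
Proof. by have [_ +_] := has_density_ln_ratio; apply. Qed.

Lemma fpq_ge0 v : 0 < v -> 0 <= fpq p q v.
Proof. by move=> v0; rewrite /fpq mulr_ge0 ?gpq_ge0// invr_ge0 ltW. Qed.

Lemma has_density_ratio : has_density P V (fun v : R => if 0 < v then fpq p q v else 0).
Proof.
have [mg g0 lnV] := has_density_ln_ratio.
have mF : measurable_fun setT (fun v : R => if 0 < v then fpq p q v else 0).
  (* For v > 0, 1/v is rewritten as e^(-ln v), which is measurable on the whole line. *)
  have -> : (fun v : R => if 0 < v then fpq p q v else 0) =
      (fun v : R => if 0 < v then expR (- ln v) * complex.Re (gpq p q (ln v)) else 0).
    by apply/funext => v; case: ifPn => // v0; rewrite /fpq expRN lnK ?posrE.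
  apply: measurable_fun_ifT => //; first exact: measurable_fun_ltr.
  apply: measurable_funM.
  - apply: (measurableT_comp (@measurable_expR R)); exact: measurable_funN.
  - exact: (measurableT_comp mg (@measurable_ln R)).
apply: has_density_pos => //.
- by move=> x; case: ifP => //; exact: fpq_ge0.
- exact: probability_npos.
- by move=> x; rewrite leNgt => /negbTE ->.
move=> a b a0 ab; have b0 := lt_trans a0 ab.
have -> : P (V @^-1` `]a, b]) = P ((fun w => ln (V w)) @^-1` `]ln a, ln b]).
  have mA : measurable ((fun w => ln (V w)) @^-1` `]ln a, ln b]).
    rewrite -[X in measurable X]setTI.
    exact: (measurableT_comp (@measurable_ln R) (measurable_funPT V) measurableT).
  have mB : measurable (V @^-1` `]a, b]) by exact: measurable_funPTI.
  (* The events can differ where V <= 0, by the default values of [ln]; adjoining this null event to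
     both makes them equal. *)
  rewrite -(measureU0 mA measurable_npos probability_npos).
  rewrite -(measureU0 mB measurable_npos probability_npos).
  congr (P _); apply/seteqP.
  have lnE w : 0 < V w -> (ln a < ln (V w) <= ln b) = (a < V w <= b).
    by move=> Vw; rewrite ltr_ln ?posrE// ler_ln ?posrE.
  split => w /=; rewrite !in_itv/=; have [Vw|Vw] := leP (V w) 0; try by right.
  - by move=> [abw|//]; left; rewrite lnE.
  - by move=> [abw|//]; left; rewrite -lnE.
rewrite -[LHS]/(pushforward P (fun w => ln (V w)) `]ln a, ln b]) lnV//.
rewrite !integral_itv_obnd_cbnd; last 2 first.
- by apply/measurable_EFinP; exact: measurable_funTS.
- by apply/measurable_EFinP; exact: measurable_funTS.
transitivity (\int[mu]_(v in `[a, b]) (complex.Re (gpq p q (ln v)) * v^-1)%:E)%E; last first.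
  apply: eq_integral => v; rewrite inE/= in_itv/= => /andP[av vb].
  by rewrite (lt_le_trans a0 av) /fpq mulrC.
(* Any number below [ln a] would do as left bound, because the density of log V is continuous on the
   whole line. *)
apply: (@integral_substitution R (fun y => complex.Re (gpq p q y)) (@ln R) (fun v => v^-1) (ln a - 1)).
- exact: ltW.
- by lra.
- by move=> x _; exact: continuous_gpq_re.
- move=> x /andP[ax xb]; have x0 := lt_le_trans a0 ax.
  by rewrite !ler_ln ?posrE// ax.
- move=> x /andP[ax xb]; have x0 := lt_le_trans a0 ax.
  exact: is_derive1_ln.
- move=> x /andP[ax xb]; have x0 := lt_le_trans a0 ax.
  by apply: inv_continuous; rewrite gt_eqF.
Qed.

End ratio_law.

Theorem mainTheorem4 (R : realType) (p q : R) (hp : 0 < p) (hpq : p < q) :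
  [/\ L1C (Phi p q),
      (forall y : R, Im (gpq p q y) = 0),
      continuous (fun y : R => Re (gpq p q y)) &
      forall (d : measure_display) (T : measurableType d)
        (P : probability T R) (V Xq : {RV P >-> R})
        (d' : measure_display) (T' : measurableType d')
        (P' : probability T' R) (Xp : {RV P' >-> R}),
        {ae P, forall w, 0 < V w} ->
        has_density P Xq (gnormal_pdf q) ->
        has_density P' Xp (gnormal_pdf p) ->
        independent_RV P V Xq ->
        eq_in_law P' Xp P (fun w => V w * Xq w) ->
        [/\ has_density P (fun w => ln (V w)) (fun y => Re (gpq p q y)),
            has_density P V (fun v => if 0 < v then fpq p q v else 0) &
            forall v : R, 0 < v -> 0 <= fpq p q v]].
Proof.
split.
- exact: L1C_Phi.
- exact: gpq_im.
- exact: continuous_gpq_re.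
move=> d T P V Xq d' T' P' Xp V0 Xq_density Xp_density VXq Xp_law; split.
- exact: has_density_ln_ratio V0 Xq_density Xp_density VXq Xp_law.
- exact: has_density_ratio V0 Xq_density Xp_density VXq Xp_law.
- exact: fpq_ge0 V0 Xq_density Xp_density VXq Xp_law.
Qed.
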